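(* Let $0\neq p(x)\in\mathbb C((x))$, $\phi(x,z)=e^{zp(x)\frac{d}{dx}}(x)$, $\bar p(x)=x^{-1}p(x)$. Let $G$ be a group with linear characters $\chi,\chi_\phi:G\to\mathbb C^\times$ satisfying $\phi(x,\chi(g)z)=\chi_\phi(g)\phi(\chi_\phi(g)^{-1}x,z)$ for all $g\in G$. Let $(V,R)$ be a $(G,\chi)$-vertex algebra and let $(W,Y_W)$ be a $(G,\chi_\phi)$-equivariant $\phi$-coordinated quasi $V$-module. Let $\psi:\chi_\phi(G)\to G$ be a section of $\chi_\phi$. Then for $u,v\in V$, $$[Y_W(u,z_1),Y_W(v,z_2)]=\mathrm{Res}_{z_0}\sum_{g\in\psi(\chi_\phi(G))}Y_W(Y(R_{g^{-1}}u,z_0)v,z_2)\,e^{z_0p(z_2)\frac{\partial}{\partial z_2}}\left(\chi(g)\,\bar p(z_1)\,\delta\!\left(\frac{\chi_\phi(g)z_2}{z_1}\right)\right).$$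
   Context: $\phi(x,z)=\sum_{n\ge0}\frac{z^n}{n!}\left(p(x)\frac{d}{dx}\right)^n(x)\in\mathbb C((x))[[z]]$; $\delta(z)=\sum_{n\in\mathbb Z}z^n$; $\mathrm{Res}_{z_0}$ is the coefficient of $z_0^{-1}$. A section of $\chi_\phi$ is a map (of sets) $\psi$ with $\chi_\phi\circ\psi=\mathrm{id}$ on $\chi_\phi(G)$. The sum has only finitely many nonzero contributions after taking $\mathrm{Res}_{z_0}$. A $(G,\chi)$-vertex algebra is a pair $(V,R)$ of a vertex algebra $(V,Y,\mathbf 1)$ and a group homomorphism $R:G\to\mathrm{GL}(V)$ with $R_g(\mathbf 1)=\mathbf 1$ and $R_gY(v,z)R_g^{-1}=Y(R_g(v),\chi(g)z)$ for $g\in G,v\in V$. $W((z_1,z_2))=W[[z_1,z_2]][z_1^{-1},z_2^{-1}]$; for $A\in\mathrm{Hom}(W,W((z_1,z_2)))$, $A(z_1,z_2)|_{z_1=\phi(z_2,z_0)}=\left(e^{z_0p(z_1)\partial/\partial z_1}A(z_1,z_2)\right)|_{z_1=z_2}$. A $\phi$-coordinated quasi $V$-module is a vector space $W$ with a linear map $Y_W(\cdot,z):V\to\mathrm{Hom}(W,W((z)))$ such that $Y_W(\mathbf 1,z)=1_W$ and for all $u,v\in V$ there is a nonzero polynomial $f(z_1,z_2)\in\mathbb C[z_1,z_2]$ with $f(z_1,z_2)Y_W(u,z_1)Y_W(v,z_2)\in\mathrm{Hom}(W,W((z_1,z_2)))$ and $f(\phi(z_2,z_0),z_2)Y_W(Y(u,z_0)v,z_2)=\left(f(z_1,z_2)Y_W(u,z_1)Y_W(v,z_2)\right)|_{z_1=\phi(z_2,z_0)}$.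 For a subgroup $\Gamma\le\mathbb C^\times$, $\mathbb C_\Gamma[z]$ is the set of monic polynomials in $\mathbb C[z]$ all of whose roots lie in $\Gamma$. A $(G,\chi_\phi)$-equivariant $\phi$-coordinated quasi $V$-module is a $\phi$-coordinated quasi $V$-module $(W,Y_W)$ such that $Y_W(R_gv,z)=Y_W(v,\chi_\phi(g)^{-1}z)$ for $g\in G,v\in V$, and for all $u,v\in V$ there is $q(z)\in\mathbb C_{\chi_\phi(G)}[z]$ with $q(z_1/z_2)Y_W(u,z_1)Y_W(v,z_2)\in\mathrm{Hom}(W,W((z_1,z_2)))$. *)

(* Defs.v *)
From HB Require Import structures.
From mathcomp Require Import all_boot all_order all_algebra.
From mathcomp Require Import boolp classical_sets functions cardinality fsbigop.

Set Implicit Arguments.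
Unset Strict Implicit.
Unset Printing Implicit Defensive.

Import GRing.Theory.
Local Open Scope classical_set_scope.
Local Open Scope ring_scope.

(* A formal distribution with coefficients in W is its coefficient function:
   a : int -> W stands for \sum_n a_n z^n and A : int -> int -> W for
   \sum_(m, n) A_(m, n) z_1^m z_2^n.  For a distribution in z_0 and z_2 the
   exponent of z_0 comes first.  The sums \sum_(i \in setT) _ are finitely
   supported on all the series they are applied to here (they would be 0 on an
   infinite support). *)

Section Series.
Context {K : fieldType} {W : lmodType K}.

(* W((z)) and W((z_1, z_2)) = W[[z_1, z_2]][z_1^-1, z_2^-1] *)
Definition laurent (a : int -> W) : Prop :=
  exists N : int, forall n : int, n < N -> a n = 0.

Definition laurent2 (A : int -> int -> W) : Prop :=
  exists N : int, forall m n : int, (m < N) || (n < N) -> A m n = 0.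

(* a(x) b(x) *)
Definition lmul (a : int -> K) (b : int -> W) : int -> W :=
  fun n => \sum_(i \in [set: int]) a i *: b (n - i).

(* the same in z_0, with coefficients that are series in z_2 *)
Definition lmul2 (A : int -> int -> K) (B : int -> int -> W) :
    int -> int -> W :=
  fun k n => \sum_(i \in [set: int]) lmul (A i) (B (k - i)) n.

Definition fderiv (b : int -> W) : int -> W := fun n => b (n + 1) *~ (n + 1).

Definition pderiv (p : int -> K) (b : int -> W) : int -> W :=
  lmul p (fderiv b).

(* e^{z_0 p(x) d/dx} b(x) *)
Definition exp_pderiv (p : int -> K) (b : int -> W) : int -> int -> W :=
  fun k => if k is Posz i then fun n => (i`!%:R)^-1 *: iter i (pderiv p) b n
           else fun=> 0.

(* A(z, z) *)
Definition diagonal (A : int -> int -> W) : int -> W :=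
  fun n => \sum_(i \in [set: int]) A i (n - i).

(* A(z_1, z_2)|_{z_1 = phi(z_2, z_0)}
   = (e^{z_0 p(z_1) d/dz_1} A(z_1, z_2))|_{z_1 = z_2} *)
Definition subst_phi (p : int -> K) (A : int -> int -> W) : int -> int -> W :=
  fun k => diagonal (fun m n => exp_pderiv p (fun i => A i n) k m).

(* f(z_1, z_2) A(z_1, z_2), with f`_i`_j the coefficient of z_1^i z_2^j *)
Definition poly2_mul (f : {poly {poly K}}) (A : int -> int -> W) :
    int -> int -> W :=
  fun m n => \sum_(i < size f) \sum_(j < size f`_i)
    f`_i`_j *: A (m - i%:Z) (n - j%:Z).

(* q(z_1 / z_2) A(z_1, z_2) *)
Definition polydiv_mul (q : {poly K}) (A : int -> int -> W) :
    int -> int -> W :=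
  fun m n => \sum_(i < size q) q`_i *: A (m - i%:Z) (n + i%:Z).

End Series.

Section Phi.
Context {K : fieldType}.

(* phi(x, z) = e^{z p(x) d/dx} x; phi p k n is the coefficient of z^k x^n *)
Definition phi (p : int -> K) : int -> int -> K :=
  exp_pderiv p (fun n : int => (n == 1)%:R : K^o).

Definition series2_exp (A : int -> int -> K) (i : nat) : int -> int -> K :=
  iter i (lmul2 (W := K^o) A)
    (fun k n : int => ((k == 0) && (n == 0))%:R : K^o).

(* f(A(z_0, z_2), z_2) *)
Definition poly2_subst (f : {poly {poly K}}) (A : int -> int -> K) :
    int -> int -> K :=
  fun k n => \sum_(i < size f) \sum_(j < size f`_i)
    f`_i`_j * series2_exp A i k (n - j%:Z).

(* delta(c z_2 / z_1), as a distribution in z_1 and z_2 *)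
Definition delta_ratio (c : K) : int -> int -> K :=
  fun m n => if m == - n then c ^ n else 0.

(* c * (x^-1 p(x))|_{x = z_1} * delta(d z_2 / z_1), in z_1 and z_2 *)
Definition pbar_delta (p : int -> K) (c d : K) : int -> int -> K :=
  fun m n => c * lmul (W := K^o) (fun i => p (i + 1))
                      (fun i => delta_ratio d i n) m.

(* l (l - 1) ... (l - i + 1) / i! for l : int *)
Definition binomz (l : int) (i : nat) : K :=
  (\prod_(j < i) (l - j%:Z)%:~R) / i`!%:R.

End Phi.

Section VertexAlgebra.
Context {K : fieldType}.

(* Y v w n is the coefficient of z^n in Y(v, z) w. *)

(* the mode v_n in Y(v, z) = \sum_n v_n z^(-n-1) *)
Definition mode {V W : lmodType K} (Y : V -> W -> int -> W) (v : V) (n : int)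
  (w : W) : W := Y v w (- n - 1).

(* The coefficient of z_0^(-l-1) z_1^(-m-1) z_2^(-n-1) in
     z_0^-1 delta((z_1 - z_2) / z_0) Y(u, z_1) Y(v, z_2) w
       - z_0^-1 delta((z_2 - z_1) / (- z_0)) Y(v, z_2) Y(u, z_1) w
     = z_2^-1 delta((z_1 - z_0) / z_2) Y(Y(u, z_0) v, z_2) w,
   binomials being expanded in nonnegative powers of the second variable.
   On the right this uses (-1)^i binom(i - m - 1, i) = binom(m, i). *)
Definition jacobi_identity {V : lmodType K} (Y : V -> V -> int -> V) : Prop :=
  forall (u v w : V) (l m n : int),
    \sum_(i \in [set: nat]) ((-1) ^+ i * binomz l i) *:
        mode Y u (m + l - i%:Z) (mode Y v (n + i%:Z) w)
    - \sum_(i \in [set: nat]) ((-1) ^ l * (-1) ^+ i * binomz l i) *: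
        mode Y v (n + l - i%:Z) (mode Y u (m + i%:Z) w)
    = \sum_(i \in [set: nat]) binomz m i *:
        mode Y (mode Y u (l + i%:Z) v) (m + n - i%:Z) w.

(* Y(., z) is a linear map V -> Hom(W, W((z))) *)
Definition field_map {V W : lmodType K} (Y : V -> W -> int -> W) : Prop :=
  [/\ forall (w : W) (n : int), linear (fun v : V => Y v w n),
      forall (v : V) (n : int), linear (fun w : W => Y v w n)
    & forall (v : V) (w : W), laurent (Y v w)].

(* Y(vac, z) = 1 *)
Definition vacuum_axiom {V W : lmodType K} (Y : V -> W -> int -> W) (vac : V)
    : Prop :=
  forall (w : W) (n : int), Y vac w n = if n == 0 then w else 0.

Record vertex_algebra {V : lmodType K} (Y : V -> V -> int -> V) (vac : V)
    : Prop := VertexAlgebra {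
  va_field : field_map Y;
  va_vacuum : vacuum_axiom Y vac;
  va_creation : forall v : V,
    (forall n : int, n < 0 -> Y v vac n = 0) /\ Y v vac 0 = v;
  va_jacobi : jacobi_identity Y
}.

(* a group homomorphism G -> K^x; chi g <> 0 as chi g * chi g^-1 = 1 *)
Record linear_character {G : groupType} (chi : G -> K) : Prop :=
    LinearCharacter {
  linear_character1 : chi 1%g = 1;
  linear_characterM : forall g h : G, chi (g * h)%g = chi g * chi h
}.

(* a group homomorphism G -> GL(V) *)
Record linear_rep {G : groupType} {V : lmodType K} (R : G -> V -> V) : Prop :=
    LinearRep {
  linear_rep_linear : forall g : G, linear (R g);
  linear_rep1 : forall v : V, R 1%g v = v;
  linear_repM : forall (g h : G) (v : V), R (g * h)%g v = R g (R h v)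
}.

Record G_vertex_algebra {G : groupType} (chi : G -> K) {V : lmodType K}
    (Y : V -> V -> int -> V) (vac : V) (R : G -> V -> V) : Prop :=
    GVertexAlgebra {
  Gva_va : vertex_algebra Y vac;
  Gva_rep : linear_rep R;
  Gva_vac : forall g : G, R g vac = vac;
  Gva_conj : forall (g : G) (v w : V) (n : int),
    R g (Y v (R g^-1%g w) n) = chi g ^ n *: Y (R g v) w n
}.

(* Y_W(u, z_1) Y_W(v, z_2) w, in z_1 and z_2 *)
Definition prodY {V W : lmodType K} (YW : V -> W -> int -> W) (u v : V) (w : W)
  : int -> int -> W := fun m n => YW u (YW v w n) m.

(* [Y_W(u, z_1), Y_W(v, z_2)] w, in z_1 and z_2 *)
Definition commY {V W : lmodType K} (YW : V -> W -> int -> W) (u v : V) (w : W)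
  : int -> int -> W := fun m n => prodY YW u v w m n - prodY YW v u w n m.

(* Y_W(Y(u, z_0) v, z_2) w, in z_0 and z_2 *)
Definition iterY {V W : lmodType K} (Y : V -> V -> int -> V)
    (YW : V -> W -> int -> W) (u v : V) (w : W) : int -> int -> W :=
  fun k n => YW (Y u v k) w n.

Record phi_quasi_module (p : int -> K) {V W : lmodType K}
    (Y : V -> V -> int -> V) (vac : V) (YW : V -> W -> int -> W) : Prop :=
    PhiQuasiModule {
  pqm_field : field_map YW;
  pqm_vacuum : vacuum_axiom YW vac;
  pqm_assoc : forall u v : V, exists2 f : {poly {poly K}}, f != 0 &
    (forall w : W, laurent2 (poly2_mul f (prodY YW u v w))) /\
    (forall w : W, lmul2 (poly2_subst f (phi p)) (iterY Y YW u v w)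
                   = subst_phi p (poly2_mul f (prodY YW u v w)))
}.

(* K_Gamma[z] *)
Definition monic_roots_in (Gamma : set K) (q : {poly K}) : Prop :=
  q \is monic /\ forall c : K, root q c -> Gamma c.

Record equivariant_phi_quasi_module (p : int -> K) {G : groupType}
    (chi_phi : G -> K) {V W : lmodType K} (Y : V -> V -> int -> V) (vac : V)
    (R : G -> V -> V) (YW : V -> W -> int -> W) : Prop :=
    EquivariantPhiQuasiModule {
  epqm_module : phi_quasi_module p Y vac YW;
  epqm_equiv : forall (g : G) (v : V) (w : W) (n : int),
    YW (R g v) w n = (chi_phi g)^-1 ^ n *: YW v w n;
  epqm_local : forall u v : V, exists2 q : {poly K},
    monic_roots_in (range chi_phi) q &
    forall w : W, laurent2 (polydiv_mul q (prodY YW u v w))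
}.

(* The coefficient of z_1^m z_2^n in
     Res_{z_0} Y_W(Y(R_{g^-1} u, z_0) v, z_2) w
       e^{z_0 p(z_2) d/dz_2} (chi(g) pbar(z_1) delta(chi_phi(g) z_2 / z_1)). *)
Definition res_term (p : int -> K) {G : groupType} (chi chi_phi : G -> K)
    {V W : lmodType K} (Y : V -> V -> int -> V) (R : G -> V -> V)
    (YW : V -> W -> int -> W) (u v : V) (g : G) (w : W) : int -> int -> W :=
  fun m n =>
    lmul2 (exp_pderiv p (pbar_delta p (chi g) (chi_phi g) m : int -> K^o))
          (iterY Y YW (R g^-1%g u) v w) (-1) n.

End VertexAlgebra.

(* Main.v *)
Require Import Defs.
From HB Require Import structures.
From mathcomp Require Import all_boot all_order all_algebra.
From mathcomp Require Import boolp classical_sets functions cardinality fsbigop.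
From mathcomp Require Import reals complex.
From mathcomp Require Import zify ring.

Set Implicit Arguments.
Unset Strict Implicit.
Unset Printing Implicit Defensive.
Import Order.TTheory GRing.Theory Num.Theory.
Local Open Scope classical_set_scope.
Local Open Scope ring_scope.

(** Fix a vector w of W and a linear functional lam on W, and apply lam to all
    coefficients: every series becomes a series over K, and since functionals
    separate vectors ([functional_ext]) nothing is lost.  The Laurent series
    over a field form a field ([lau]), so K((z))((z0)) is a field too, and
    fractions may be formed, cancelled and expanded in it.  Put
    A = Y_W(u, z1) Y_W(v, z2) w and B = Y_W(v, z2) Y_W(u, z1) w.

    The substitution z1 = phi(z2, z0) is the operator [phisub] on series in
    K((z1, z2)).  It turns multiplication by a series in z1 into multiplication
    by its value at phi, is linear over the series in z2, satisfies a chain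
    rule, and is injective because p is not zero and K has characteristic zero
    ([phisub_inj]).

    Common numerator.  Locality for (u, v) and for (v, u) gives a polynomial Q
    with all roots in the image of chi_phi such that Q(z1/z2) A and
    Q(z1/z2) B both lie in K((z1, z2)).  Associativity gives
    Q(phi/z2) X = Q A at z1 = phi, where X is the image of Y_W(Y(u, z0) v, z2),
    and likewise for (v, u).  Skew symmetry of V says that X for (v, u) arises
    from X for (u, v) by the involution [flip] (z0 to -z0, then z2 to phi), and
    this involution turns the substitution z2 = phi into the substitution
    z1 = phi ([flip_phisub]).  Hence Q A and Q B have the same image under an
    injective map: Q A = Q B = F ([common_numerator]).

    Residues.  A and B are thus the expansions of the one fraction F/Q in the
    domains |z1| > |z2| and |z2| > |z1|, and a coefficient of A - B is a
    difference of residues.  By [residue_theorem] this difference is the sum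
    over the roots e of Q of the residue of F/Q at z1 = e z2, computed in the
    local coordinate z0 with z1 = e phi(z2, z0).  Equivariance identifies the
    expansion of F/Q there with Y_W(Y(R_g^-1 u, z0) v, z2) for chi_phi(g) = e,
    and the relation chi(g) p(e x) = e p(x), which is the coefficient of z in
    the compatibility of chi with chi_phi, turns dz1 into the factor
    chi(g) pbar(z1) delta(e z2/z1) of the formula.  At points that are not
    roots of Q there is no pole, which is why almost all terms vanish. *)

(** * Finitely supported sums *)

Section FiniteSums.
Variables (I : choiceType) (V : zmodType).
Implicit Types f g : I -> V.

(** A sum over an infinite set is 0 unless its support is finite, so every
    rearrangement below needs such a witness. *)
Definition fsup (I : choiceType) (V : zmodType) (f : I -> V) : Prop :=
  exists r : seq I, forall i, i \notin r -> f i = 0.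

Lemma fsumE (r : seq I) f : uniq r -> (forall i, i \notin r -> f i = 0) ->
  \sum_(i \in [set: I]) f i = \sum_(i <- r) f i.
Proof.
move=> ur f0; rewrite (fsbigE r) //; last by move=> i _; apply: f0.
by apply: eq_bigl => i; rewrite in_setT.
Qed.

Lemma fsup_uniq f : fsup f ->
  exists r : seq I, uniq r /\ forall i, i \notin r -> f i = 0.
Proof.
case=> r f0; exists (undup r); split; first exact: undup_uniq.
by move=> i; rewrite mem_undup => /f0.
Qed.

Lemma fsup2_uniq f g : fsup f -> fsup g -> exists r : seq I,
  [/\ uniq r, forall i, i \notin r -> f i = 0 & forall i, i \notin r -> g i = 0].
Proof.
move=> [r f0] [s g0]; exists (undup (r ++ s)); split; first exact: undup_uniq.
  by move=> i; rewrite mem_undup mem_cat negb_or => /andP[/f0].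
by move=> i; rewrite mem_undup mem_cat negb_or => /andP[_ /g0].
Qed.

Lemma eq_fsum f g : (forall i, f i = g i) ->
  \sum_(i \in [set: I]) f i = \sum_(i \in [set: I]) g i.
Proof. by move=> fg; apply: eq_fsbigr => i _; apply: fg. Qed.

Lemma fsum0 f : (forall i, f i = 0) -> \sum_(i \in [set: I]) f i = 0.
Proof. by move=> f0; apply: fsbig1 => i _. Qed.

Lemma fsum1 j f : (forall i, i != j -> f i = 0) ->
  \sum_(i \in [set: I]) f i = f j.
Proof.
move=> f0; rewrite (@fsumE [:: j]) ?big_seq1 // => i.
by rewrite inE => /f0.
Qed.

Lemma fsumD f g : fsup f -> fsup g ->
  \sum_(i \in [set: I]) (f i + g i)
  = \sum_(i \in [set: I]) f i + \sum_(i \in [set: I]) g i.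
Proof.
move=> sf sg; have [r [ur f0 g0]] := fsup2_uniq sf sg.
rewrite !(@fsumE r) // ?big_split // => i ri.
by rewrite f0 ?g0 ?addr0.
Qed.

End FiniteSums.

Lemma fsum_exchange (I J : choiceType) (V : zmodType) (r : seq I) (s : seq J)
    (h : I -> J -> V) :
  (forall i j, i \notin r -> h i j = 0) ->
  (forall i j, j \notin s -> h i j = 0) ->
  \sum_(i \in [set: I]) \sum_(j \in [set: J]) h i j
  = \sum_(j \in [set: J]) \sum_(i \in [set: I]) h i j.
Proof.
move=> hr hs; rewrite (@fsumE _ _ (undup r)) ?undup_uniq //; last first.
  by move=> i; rewrite mem_undup => ri; apply: fsum0 => j; apply: hr.
rewrite [RHS](@fsumE _ _ (undup s)) ?undup_uniq //; last first.
  by move=> j; rewrite mem_undup => sj; apply: fsum0 => i; apply: hs.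
under eq_bigr => i _.
  rewrite (@fsumE _ _ (undup s)) ?undup_uniq //; last first.
    by move=> j; rewrite mem_undup; apply: hs.
  over.
rewrite exchange_big /=; apply: eq_bigr => j _.
by rewrite (@fsumE _ _ (undup r)) ?undup_uniq // => i; rewrite mem_undup;
   apply: hr.
Qed.

Section AdditiveMaps.
Variables (V U : zmodType) (h : V -> U) (hD : forall x y, h (x + y) = h x + h y).

Lemma additive0 : h 0 = 0.
Proof. by apply: (@addIr _ (h 0)); rewrite -hD !add0r. Qed.

Lemma additiveN x : h (- x) = - h x.
Proof. by apply: (@addrI _ (h x)); rewrite -hD !subrr additive0. Qed.

Lemma additiveB x y : h (x - y) = h x - h y.
Proof. by rewrite hD additiveN. Qed.

Lemma additiveMz x k : h (x *~ k) = h x *~ k.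
Proof.
have hn n : h (x *+ n) = h x *+ n.
  by elim: n => [|n IH]; rewrite ?additive0 // !mulrS hD IH.
by case: k => k; rewrite ?NegzE ?mulrNz ?additiveN -!pmulrn hn.
Qed.

End AdditiveMaps.

Lemma fsum_morph (I : choiceType) (V U : zmodType) (h : V -> U) (f : I -> V) :
    (forall x y, h (x + y) = h x + h y) -> fsup f ->
  h (\sum_(i \in [set: I]) f i) = \sum_(i \in [set: I]) h (f i).
Proof.
move=> hD /fsup_uniq[r [ur f0]].
have h0 := additive0 hD; rewrite !(@fsumE _ _ r) //.
  exact: (big_morph h hD h0).
by move=> i /f0 ->.
Qed.

Lemma fsum_shift (V : zmodType) (c : int) (f : int -> V) :
  \sum_(i \in [set: int]) f i = \sum_(i \in [set: int]) f (i + c).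
Proof.
apply: (@reindex_fsbigT _ _ _ _ _ (fun i => i + c)).
by exists (fun i => i - c) => i; rewrite ?addrK ?subrK.
Qed.

Lemma fsum_rev (V : zmodType) (c : int) (f : int -> V) :
  \sum_(i \in [set: int]) f i = \sum_(i \in [set: int]) f (c - i).
Proof.
apply: (@reindex_fsbigT _ _ _ _ _ (fun i => c - i)).
by exists (fun i => c - i) => i; rewrite subKr.
Qed.

Definition zint (a b : int) : seq int :=
  [seq a + i%:Z | i <- iota 0 `|b - a|.+1].

Arguments zint : simpl never.

Lemma mem_zint (a b i : int) : a <= i -> i <= b -> i \in zint a b.
Proof.
move=> ai ib; apply/mapP; exists `|i - a|%N; last by lia.
by rewrite mem_iota; lia.
Qed.

Lemma notin_zint (a b i : int) : i \notin zint a b -> (i < a) \/ (b < i).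
Proof.
have [ia|ai] := ltP i a; first by left.
have [bi|ib] := ltP b i; first by right.
by rewrite mem_zint.
Qed.

Lemma fsup_zint (V : zmodType) (a b : int) (f : int -> V) :
  (forall i, i < a -> f i = 0) -> (forall i, b < i -> f i = 0) -> fsup f.
Proof. by move=> fa fb; exists (zint a b) => i /notin_zint[/fa|/fb]. Qed.

Lemma ltz0_Negz (z : int) : z < 0 -> exists k, z = Negz k.
Proof. by case: z => // k _; exists k. Qed.

Lemma eq_zsum (V : zmodType) (f g : int -> V) : (forall i, f i = g i) ->
  \sum_(i \in [set: int]) f i = \sum_(i \in [set: int]) g i.
Proof. exact: eq_fsum. Qed.

Lemma zsum0 (V : zmodType) (f : int -> V) : (forall i, f i = 0) ->
  \sum_(i \in [set: int]) f i = 0.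
Proof. exact: fsum0. Qed.

Lemma zsum1 (V : zmodType) (j : int) (f : int -> V) :
  (forall i, i != j -> f i = 0) -> \sum_(i \in [set: int]) f i = f j.
Proof. exact: fsum1. Qed.

Lemma fsum_nat (V : zmodType) (M : nat) (f : int -> V) :
    (forall i, i < 0 -> f i = 0) -> (forall i, M%:Z <= i -> f i = 0) ->
  \sum_(i \in [set: int]) f i = \sum_(i < M) f i%:Z.
Proof.
move=> f0 fM; rewrite (@fsumE _ _ [seq i%:Z | i <- iota 0 M]).
- by rewrite big_map -(big_mkord xpredT (fun i => f i%:Z)) /index_iota subn0.
- by rewrite map_inj_uniq ?iota_uniq // => i j [].
case=> i; last by move=> _; apply: f0.
have [iM|Mi _] := ltnP i M; last exact: fM.
by move/negP; case; apply: map_f; rewrite mem_iota.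
Qed.

(** * The field of Laurent series *)

Definition bounded_below (V : zmodType) (f : int -> V) : Prop :=
  exists N : int, forall n : int, n < N -> f n = 0.

Record lau (R : fieldType) := Lau {
  coefl :> int -> R;
  lauP : bounded_below coefl
}.

HB.instance Definition _ (R : fieldType) := gen_eqMixin (lau R).
HB.instance Definition _ (R : fieldType) := gen_choiceMixin (lau R).

Section Laurent.
Variable R : fieldType.
Implicit Types x y : lau R.

Lemma lau_eq x y : (forall n, x n = y n) -> x = y.
Proof.
case: x y => f Pf [g Pg] /= fg; have {}fg : f = g by apply: funext.
by rewrite fg in Pf *; congr Lau; apply: Prop_irrelevance.
Qed.

Lemma lzero_subproof : bounded_below (fun _ : int => 0 : R).
Proof. by exists 0. Qed.
Definition lzero := Lau lzero_subproof.

Lemma lopp_subproof x : bounded_below (fun n => - x n).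
Proof. by case: (lauP x) => N x0; exists N => n /x0 ->; rewrite oppr0. Qed.
Definition lopp x := Lau (lopp_subproof x).

Lemma ladd_subproof x y : bounded_below (fun n => x n + y n).
Proof.
case: (lauP x) (lauP y) => N x0 [M y0]; exists (Order.min N M) => n.
by rewrite lt_min => /andP[/x0-> /y0->]; rewrite addr0.
Qed.
Definition ladd x y := Lau (ladd_subproof x y).

Lemma laddA : associative ladd.
Proof. by move=> x y z; apply: lau_eq => n /=; rewrite addrA. Qed.
Lemma laddC : commutative ladd.
Proof. by move=> x y; apply: lau_eq => n /=; rewrite addrC. Qed.
Lemma ladd0 : left_id lzero ladd.
Proof. by move=> x; apply: lau_eq => n /=; rewrite add0r. Qed.
Lemma laddN : left_inverse lzero lopp ladd.
Proof. by move=> x; apply: lau_eq => n /=; rewrite addNr. Qed.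

HB.instance Definition _ := GRing.isZmodule.Build (lau R) laddA laddC ladd0 laddN.

Lemma laucD x y n : (x + y) n = x n + y n. Proof. by []. Qed.
Lemma lauc0 n : (0 : lau R) n = 0. Proof. by []. Qed.
Lemma laucN x n : (- x) n = - x n. Proof. by []. Qed.
Lemma laucB x y n : (x - y) n = x n - y n. Proof. by []. Qed.

Lemma lauc_sum (I : Type) (r : seq I) (P : pred I) (F : I -> lau R) n :
  (\sum_(i <- r | P i) F i) n = \sum_(i <- r | P i) F i n.
Proof. by elim/big_rec2: _ => // i y x _ <-. Qed.

Lemma lauc_muln x k n : (x *+ k) n = x n *+ k.
Proof. by elim: k => // k IH; rewrite !mulrS laucD IH. Qed.

Lemma lauc_mulz x k n : (x *~ k) n = x n *~ k.
Proof.
by case: k => k; rewrite ?laucN ?lauc_muln // NegzE !mulrNz laucN lauc_muln.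
Qed.

Definition conv (f g : int -> R) : int -> R :=
  fun n => \sum_(i \in [set: int]) f i * g (n - i).

Lemma conv_bound (N M : int) (f g : int -> R) :
    (forall n, n < N -> f n = 0) -> (forall n, n < M -> g n = 0) ->
  forall n i, i \notin zint N (n - M) -> f i * g (n - i) = 0.
Proof.
move=> f0 g0 n i /notin_zint[/f0->|lei]; first by rewrite mul0r.
by rewrite g0 ?mulr0 //; lia.
Qed.

Lemma conv_fsup x y n : fsup (fun i => x i * y (n - i)).
Proof.
case: (lauP x) (lauP y) => N x0 [M y0].
by exists (zint N (n - M)); apply: conv_bound.
Qed.

Lemma conv_lower (N M : int) (f g : int -> R) :
    (forall n, n < N -> f n = 0) -> (forall n, n < M -> g n = 0) ->
  forall n, n < N + M -> conv f g n = 0.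
Proof.
move=> f0 g0 n nNM; apply: zsum0 => i.
have [/f0->|Ni] := ltP i N; first by rewrite mul0r.
by rewrite g0 ?mulr0 //; lia.
Qed.

Lemma lmul_subproof x y : bounded_below (conv x y).
Proof.
case: (lauP x) (lauP y) => N x0 [M y0].
by exists (N + M); apply: conv_lower.
Qed.
(* Locked to keep unification from unfolding products into sums. *)
Definition laumul := locked (fun x y => Lau (lmul_subproof x y)).

Lemma laumulE x y n : laumul x y n = conv x y n.
Proof. by rewrite /laumul -lock. Qed.

Definition lmono_fun (c : R) (k n : int) : R := if n == k then c else 0.
Lemma lmono_subproof c k : bounded_below (lmono_fun c k).
Proof. by exists k => n nk; rewrite /lmono_fun lt_eqF. Qed.
Definition lmono c k := Lau (lmono_subproof c k).

Lemma laumulC : commutative laumul.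
Proof.
move=> x y; apply: lau_eq => n; rewrite !laumulE /conv (fsum_rev n).
by apply: eq_zsum => i; rewrite subKr mulrC.
Qed.

Lemma laumul_mono c k x n : laumul (lmono c k) x n = c * x (n - k).
Proof.
rewrite laumulE /conv (@zsum1 _ k) /= /lmono_fun ?eqxx //.
by move=> i /negPf->; rewrite mul0r.
Qed.

Lemma laumul1 : left_id (lmono 1 0) laumul.
Proof. by move=> x; apply: lau_eq => n; rewrite laumul_mono mul1r subr0. Qed.

Lemma laumulD : left_distributive laumul ladd.
Proof.
move=> x y z; apply: lau_eq => n /=; rewrite !laumulE /conv -fsumD; [|exact: conv_fsup..].
by apply: eq_zsum => i /=; rewrite mulrDl.
Qed.

Lemma laumulA : associative laumul.
Proof.
move=> x y z; apply: lau_eq => n; rewrite !laumulE /conv.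
case: (lauP x) (lauP y) (lauP z) => N x0 [M y0] [L z0].
transitivity (\sum_(i \in [set: int]) \sum_(j \in [set: int])
    x j * (y (i - j) * z (n - i))); last first.
  apply: eq_zsum => i; rewrite laumulE (fsum_morph (h := fun t => t * _));
    first last.
  - exact: conv_fsup.
  - by move=> s t; rewrite mulrDl.
  by apply: eq_zsum => j; rewrite mulrA.
transitivity (\sum_(j \in [set: int]) \sum_(i \in [set: int])
    x j * (y (i - j) * z (n - i))).
  apply: eq_zsum => j; rewrite laumulE.
  rewrite (fsum_morph (h := fun t => _ * t)); first last.
  - exact: conv_fsup.
  - by move=> s t; rewrite mulrDr.
  rewrite (fsum_shift (- j)); apply: eq_zsum => i /=.
  by congr (_ * (_ * z _)); lia.
apply: (@fsum_exchange _ _ _ (zint N (n - L - M)) (zint (N + M) (n - L))).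
  move=> j i /notin_zint[/x0->|lj]; first by rewrite mul0r.
  have [ijM|Mij] := ltP (i - j) M; first by rewrite y0 // mul0r mulr0.
  by rewrite z0 ?mulr0 //; lia.
move=> j i /notin_zint[li|li]; last by rewrite z0 ?mulr0 //; lia.
have [/x0->|jN] := ltP j N; first by rewrite mul0r.
by rewrite y0 ?mul0r ?mulr0 //; lia.
Qed.

Lemma lauone_neq0 : lmono 1 0 != 0 :> lau R.
Proof.
apply/eqP => /(congr1 (fun x : lau R => x 0)) /=.
by rewrite /lmono_fun eqxx => /eqP; rewrite oner_eq0.
Qed.

HB.instance Definition _ := GRing.Zmodule_isComNzRing.Build (lau R)
  laumulA laumulC laumul1 laumulD lauone_neq0.

Lemma laucM x y n : (x * y) n = \sum_(i \in [set: int]) x i * y (n - i).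
Proof. exact: laumulE. Qed.

Lemma lauM_lower (N M : int) x y :
    (forall n, n < N -> x n = 0) -> (forall n, n < M -> y n = 0) ->
  forall n, n < N + M -> (x * y) n = 0.
Proof. by move=> x0 y0 n nNM; rewrite laucM; apply: conv_lower x0 y0 _ nNM. Qed.

Lemma lauc1 n : (1 : lau R) n = if n == 0 then 1 else 0.
Proof. by []. Qed.
Lemma laucE c k n : lmono c k n = if n == k then c else 0.
Proof. by []. Qed.
Lemma lauc_mono c k x n : (lmono c k * x) n = c * x (n - k).
Proof. exact: laumul_mono. Qed.

Lemma lmonoM c k d l : lmono c k * lmono d l = lmono (c * d) (k + l).
Proof.
apply: lau_eq => n; rewrite lauc_mono !laucE.
by rewrite subr_eq addrC; case: ifP; rewrite ?mulr0.
Qed.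

Lemma lau_lead x y (N M : int) :
  (forall n, n < N -> x n = 0) -> (forall n, n < M -> y n = 0) ->
  (x * y) (N + M) = x N * y M.
Proof.
move=> xN yM; rewrite laucM (@zsum1 _ N); first by congr (_ * y _); lia.
move=> i; rewrite neq_lt => /orP[/xN->|iN]; first by rewrite mul0r.
by rewrite yM ?mulr0 //; lia.
Qed.

Lemma lau_valP x : x != 0 ->
  exists N : int, x N != 0 /\ forall n, n < N -> x n = 0.
Proof.
move=> xn0; case: (lauP x) => N x0.
have ex : exists k : nat, x (N + k%:Z) != 0.
  apply: contrapT => /forallNP x0'; case/eqP: xn0; apply: lau_eq => n.
  have [/x0->//|Nn] := ltP n N; apply/eqP; apply: contrapT => /negP xn.
  by apply: (x0' `|n - N|%N); rewrite (_ : N + _ = n) //; lia.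
exists (N + (ex_minn ex)%:Z); case: ex_minnP => k xk kmin; split=> // n nk.
have [/x0->//|Nn] := ltP n N; apply/eqP; apply: contrapT => /negP xn.
by have := kmin `|n - N|%N; rewrite (_ : N + _ = n) => [/(_ xn)|]; lia.
Qed.

(** The first n coefficients of 1/f for a power series f with f 0 != 0: each
    is computed from the previous ones by comparing coefficients in
    (1/f) f = 1. *)
Fixpoint inv_coefs (f : nat -> R) (n : nat) : seq R :=
  if n is k.+1 then
    let s := inv_coefs f k in
    rcons s ((f 0%N)^-1 * ((k == 0%N)%:R - \sum_(i < k) s`_i * f (k - i)%N))
  else [::].

Lemma size_inv_coefs f n : size (inv_coefs f n) = n.
Proof. by elim: n => // n IH /=; rewrite size_rcons IH. Qed.

Lemma inv_coefs_nth f n m i : (i < m)%N -> (m <= n)%N ->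
  (inv_coefs f n)`_i = (inv_coefs f m)`_i.
Proof.
move=> im; elim: n => [|n IH]; first by rewrite leqn0 => /eqP->.
rewrite leq_eqVlt ltnS => /orP[/eqP->//|mn] /=.
by rewrite nth_rcons size_inv_coefs (leq_trans im mn) IH.
Qed.

Lemma inv_coefsP f : f 0%N != 0 -> exists g : nat -> R,
  forall n, \sum_(i < n.+1) g i * f (n - i)%N = (n == 0%N)%:R.
Proof.
move=> f0; exists (fun n => (inv_coefs f n.+1)`_n) => n.
rewrite big_ord_recr /= subnn nth_rcons size_inv_coefs ltnn eqxx.
rewrite mulrAC mulVf // mul1r addrC -[RHS]addr0 -addrA; congr (_ + _).
rewrite addrC; apply/eqP; rewrite subr_eq0; apply/eqP.
apply: eq_bigr => i _; congr (_ * _).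
by rewrite -[rcons _ _]/(inv_coefs f i.+1) (@inv_coefs_nth f n i.+1).
Qed.

(** Dividing by the lowest power reduces to the inversion of a power series. *)
Lemma lau_inv_ex x : exists y, x != 0 -> y * x = 1.
Proof.
have [->|xn0] := eqVneq x 0; first by exists 0.
have [N [xN x0]] := lau_valP xn0.
have [|g gP] := @inv_coefsP (fun k => x (N + k%:Z)); first by rewrite addr0.
have yb : bounded_below (fun n : int => if n + N is Posz k then g k else 0).
  exists (- N) => n nN; have [|k ->//] := @ltz0_Negz (n + N); lia.
exists (Lau yb) => _; apply: lau_eq => n; rewrite lauc1 laucM.
have [n0|n0] := ltP n 0.
  rewrite (lt_eqF n0); apply: zsum0 => i /=.
  have [le|le] := ltP (n - i) N; first by rewrite x0 ?mulr0.
  have [k ->] : exists k, i + N = Negz k by apply: ltz0_Negz; lia.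
  by rewrite mul0r.
rewrite (fsum_shift (- N)) (@fsum_nat _ `|n|%N.+1) /=; first last.
- by move=> i ni; rewrite x0 ?mulr0 //; lia.
- by move=> i /ltz0_Negz[k ->]; rewrite subrK mul0r.
transitivity (\sum_(i < `|n|%N.+1) g i * x (N + (`|n| - i)%N%:Z)).
  apply: eq_bigr => i _; rewrite subrK; congr (_ * x _).
  by have := ltn_ord i; lia.
by rewrite gP (_ : (`|n|%N == 0%N) = (n == 0)); [case: eqP|lia].
Qed.

Definition lauinv x : lau R :=
  if x == 0 then 0 else xget 0 [set y | y * x = 1].

Lemma lauinvP x : x != 0 -> lauinv x * x = 1.
Proof.
rewrite /lauinv => xn0; rewrite (negPf xn0).
by case: xgetP => [y _ //|]; have [y /(_ xn0) yx /(_ y)] := lau_inv_ex x.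
Qed.

Lemma lauinv0 : lauinv 0 = 0. Proof. by rewrite /lauinv eqxx. Qed.

HB.instance Definition _ :=
  GRing.ComNzRing_isField.Build (lau R) lauinvP lauinv0.

End Laurent.

(** Total, to avoid carrying proofs of boundedness in terms: the value is a
    junk one when f has infinitely many negative exponents. *)
Definition mkl (R : fieldType) (f : int -> R) : lau R :=
  xget 0 [set x : lau R | coefl x = f].

Section LaurentDerivations.
Variable R : fieldType.
Implicit Types x y : lau R.

Lemma mklE (f : int -> R) : bounded_below f -> forall n, mkl f n = f n.
Proof.
move=> bf n; rewrite /mkl; case: xgetP => [_ -> -> //|/(_ (Lau bf))].
by case.
Qed.

Definition lcst (c : R) : lau R := lmono c 0.

Lemma laucC c n : lcst c n = if n == 0 then c else 0. Proof. by []. Qed.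
Lemma laucCM c x n : (lcst c * x) n = c * x n.
Proof. by rewrite lauc_mono subr0. Qed.
Lemma lcst1 : lcst 1 = 1. Proof. by []. Qed.
Lemma lcst0 : lcst 0 = 0.
Proof. by apply: lau_eq => n; rewrite laucC; case: ifP. Qed.
Lemma lcstM c d : lcst (c * d) = lcst c * lcst d.
Proof. by rewrite lmonoM. Qed.
Lemma lcstD c d : lcst (c + d) = lcst c + lcst d.
Proof.
by apply: lau_eq => n; rewrite laucD !laucC; case: ifP; rewrite ?addr0.
Qed.
Lemma lcst_eq0 c : (lcst c == 0) = (c == 0).
Proof.
apply/eqP/eqP => [/(congr1 (fun x : lau R => x 0))|->]; last exact: lcst0.
by rewrite laucC eqxx.
Qed.
Lemma lcstN c : lcst (- c) = - lcst c.
Proof.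
by apply: lau_eq => n; rewrite laucN !laucC; case: ifP; rewrite ?oppr0.
Qed.
Lemma lcstV c : lcst c^-1 = (lcst c)^-1.
Proof.
have [->|c0] := eqVneq c 0; first by rewrite invr0 lcst0 invr0.
have c0' : lcst c != 0 by rewrite lcst_eq0.
by apply: (mulIf c0'); rewrite -lcstM !mulVf.
Qed.

Lemma ldiff_subproof x : bounded_below (fun n => x (n + 1) *~ (n + 1)).
Proof.
by case: (lauP x) => N x0; exists (N - 1) => n nN; rewrite x0 ?mul0rz //; lia.
Qed.
Definition ldiff x := Lau (ldiff_subproof x).

Lemma ldiffE x n : ldiff x n = x (n + 1) *~ (n + 1). Proof. by []. Qed.

Lemma ldiffD x y : ldiff (x + y) = ldiff x + ldiff y.
Proof. by apply: lau_eq => n; rewrite laucD !ldiffE laucD mulrzDl. Qed.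

Lemma ldiffM x y : ldiff (x * y) = ldiff x * y + x * ldiff y.
Proof.
apply: lau_eq => n; rewrite laucD ldiffE.
rewrite laucM (fsum_morph (h := fun t => t *~ (n + 1))); first last.
- exact: conv_fsup.
- by move=> s t; rewrite mulrzDl.
transitivity (\sum_(i \in [set: int])
   ((x i *~ i) * y (n + 1 - i) + x i * (y (n + 1 - i) *~ (n + 1 - i)))).
  apply: eq_zsum => i; rewrite mulrzAl mulrzAr -mulrzDr.
  by congr (_ *~ _); lia.
case: (lauP x) (lauP y) => N x0 [M y0].
rewrite fsumD; first last.
- apply: (@fsup_zint _ N (n + 1 - M)) => i ilt; first by rewrite x0 ?mul0r.
  by rewrite y0 ?mul0rz ?mulr0 //; lia.
- apply: (@fsup_zint _ N (n + 1 - M)) => i ilt;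
  first by rewrite x0 ?mul0rz ?mul0r.
  by rewrite y0 ?mulr0 //; lia.
congr (_ + _).
  rewrite (fsum_shift 1) laucM; apply: eq_zsum => i.
  by rewrite ldiffE; congr (_ * y _); lia.
by rewrite laucM; apply: eq_zsum => i; rewrite ldiffE addrAC.
Qed.

Lemma ldiffC c : ldiff (lcst c) = 0.
Proof.
apply: lau_eq => n; rewrite ldiffE laucC lauc0.
by case: eqP => [->|_]; rewrite ?mulr0z ?mul0rz.
Qed.

End LaurentDerivations.

Section LaurentMap.
Variable R : fieldType.
Variables (d : R -> R) (dD : forall x y, d (x + y) = d x + d y).

Definition lmap (x : lau R) : lau R := mkl (fun n => d (x n)).

Lemma lmapE x n : lmap x n = d (x n).
Proof.
apply: mklE; case: (lauP x) => N x0; exists N => m /x0 ->; exact: (additive0 dD).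
Qed.

Lemma lmapD x y : lmap (x + y) = lmap x + lmap y.
Proof. by apply: lau_eq => n; rewrite laucD !lmapE laucD dD. Qed.

Lemma lmapM : (forall x y, d (x * y) = d x * y + x * d y) ->
  forall x y, lmap (x * y) = lmap x * y + x * lmap y.
Proof.
move=> dM x y; apply: lau_eq => n; rewrite laucD lmapE !laucM.
rewrite (fsum_morph dD); last exact: conv_fsup.
rewrite -fsumD; [|exact: conv_fsup..].
by apply: eq_zsum => i; rewrite !lmapE dM.
Qed.

Lemma lmapC c : lmap (lcst c) = lcst (d c).
Proof.
by apply: lau_eq => n; rewrite lmapE !laucC; case: ifP => // _;
   apply: (additive0 dD).
Qed.

End LaurentMap.

(** * The flow of a vector field *)

Section Flow.
Variable K : numFieldType.
Notation L1 := (lau K).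
Notation L2 := (lau L1).
Variable p : L1.
Implicit Types (a b : L1) (x y : L2).

Lemma lau_mulz_eq0 a (k : int) : k != 0 -> a *~ k = 0 -> a = 0.
Proof.
move=> k0 ak; apply: lau_eq => n.
have := congr1 (fun c : L1 => c n) ak; rewrite lauc_mulz lauc0 => /eqP.
by rewrite mulrz_eq0 (negPf k0) => /eqP.
Qed.

(** The vector field D = p(z) d/dz. *)
Definition vder a : L1 := p * ldiff a.

Lemma vderD a b : vder (a + b) = vder a + vder b.
Proof. by rewrite /vder ldiffD mulrDr. Qed.

Lemma vderM a b : vder (a * b) = vder a * b + a * vder b.
Proof. by rewrite /vder ldiffM mulrDr mulrA [p * (a * _)]mulrCA. Qed.

Lemma vderC c : vder (lcst c) = 0.
Proof. by rewrite /vder ldiffC mulr0. Qed.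

Lemma vder0 : vder 0 = 0. Proof. exact: (additive0 vderD). Qed.

Lemma vderZ c a : vder (lcst c * a) = lcst c * vder a.
Proof. by rewrite vderM vderC mul0r add0r. Qed.

(** exp(z0 D) a; the outer variable is z0 and the inner one z. *)
Definition flow : L1 -> L2 := locked (fun a =>
  mkl (fun k => if k is Posz i then lcst (i`!%:R^-1) * iter i vder a else 0)).

Lemma flow_pos a (i : nat) : flow a i = lcst (i`!%:R^-1) * iter i vder a.
Proof. by rewrite /flow -lock mklE //; exists 0; case. Qed.

Lemma flow_neg a k : k < 0 -> flow a k = 0.
Proof.
move=> /ltz0_Negz[i ->]; rewrite /flow -lock mklE //; exists 0.
by move=> n /ltz0_Negz[j ->].
Qed.

Lemma flow0 a : flow a 0 = a.
Proof. by rewrite flow_pos fact0 invr1 mul1r. Qed.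

Lemma flow_ldiff a : ldiff (flow a) = flow (vder a).
Proof.
apply: lau_eq => k; rewrite ldiffE.
have [k0|k0] := ltP k 0.
  rewrite (flow_neg _ k0); have [->|k1] := eqVneq k (-1).
    by rewrite addNr mulr0z.
  by rewrite flow_neg ?mul0rz //; lia.
case: k k0 => // k _; rewrite -[1]/(1%:Z) -PoszD addn1 !flow_pos -pmulrn.
rewrite -iterSr -mulrnAl; congr (_ * _).
apply: lau_eq => n; rewrite lauc_muln !laucC.
case: ifP; rewrite ?mul0rn // => _; rewrite factS natrM invfM -mulrnAl -mulr_natr.
by rewrite mulVf ?mul1r // pnatr_eq0.
Qed.

Lemma flow_lmap a : lmap vder (flow a) = flow (vder a).
Proof.
apply: lau_eq => k; rewrite (lmapE vderD).
have [k0|] := ltP k 0; first by rewrite !flow_neg // vder0.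
by case: k => // k _; rewrite !flow_pos vderZ -iterSr.
Qed.

(** In characteristic zero the equation dx/dz0 = D x gives coefficient k + 1
    from coefficient k.  The algebraic properties of the flow follow from this
    uniqueness, without binomial sums. *)
Lemma flow_unique x y : (forall k, k < 0 -> x k = 0) ->
    (forall k, k < 0 -> y k = 0) -> x 0 = y 0 ->
  ldiff x = lmap vder x -> ldiff y = lmap vder y -> x = y.
Proof.
move=> x0 y0 xy0 dx dy; apply: lau_eq => k.
have [k0|] := ltP k 0; first by rewrite x0 ?y0.
case: k => // k _; elim: k => // k IH.
have step z : ldiff z = lmap vder z -> z k.+1%:Z *~ k.+1%:Z = vder (z k%:Z).
  by move=> /(congr1 (fun t : L2 => t k%:Z));
     rewrite ldiffE (lmapE vderD) -[1]/(1%:Z) -PoszD addn1.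
apply/eqP; rewrite -subr_eq0; apply/eqP.
by apply: (@lau_mulz_eq0 _ k.+1) => //; rewrite mulrzBl !step // IH subrr.
Qed.

Lemma flow_uniq x a : (forall k, k < 0 -> x k = 0) -> x 0 = a ->
  ldiff x = lmap vder x -> x = flow a.
Proof.
move=> x0 xa dx; apply: flow_unique => //; rewrite ?flow0 //.
  by move=> k; apply: flow_neg.
by rewrite flow_ldiff flow_lmap.
Qed.

Lemma flowD a b : flow (a + b) = flow a + flow b.
Proof.
apply/esym/flow_uniq => [k k0||]; first by rewrite laucD !flow_neg ?addr0.
  by rewrite laucD !flow0.
by rewrite ldiffD (lmapD vderD) !flow_ldiff !flow_lmap.
Qed.

(** exp(z0 D) is multiplicative: D is a derivation, so the product solves the
    differential equation of the flow. *)
Lemma flowM a b : flow (a * b) = flow a * flow b.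
Proof.
apply/esym/flow_uniq => [k k0||].
- by apply: (@lauM_lower _ 0 0) => //; exact: flow_neg.
- rewrite laucM (@zsum1 _ 0) ?subr0 ?flow0 // => i; rewrite neq_lt => /orP[i0|i0].
    by rewrite flow_neg ?mul0r.
  by rewrite [X in _ * X]flow_neg ?mulr0 // sub0r oppr_lt0.
by rewrite ldiffM (lmapM vderD vderM) !flow_ldiff !flow_lmap.
Qed.

Lemma flowC c : flow (lcst c) = lcst (lcst c).
Proof.
apply/esym/flow_uniq => [k k0||]; first by rewrite laucC lt_eqF.
  by rewrite laucC.
by rewrite ldiffC (lmapC vderD) vderC lcst0.
Qed.

Lemma flow_at0 : flow 0 = 0.
Proof. exact: (additive0 flowD). Qed.

Lemma flow_at1 : flow 1 = 1.
Proof. exact: flowC. Qed.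

Lemma flow_lcst c a k : flow (lcst c * a) k = lcst c * flow a k.
Proof. by rewrite flowM flowC laucCM. Qed.

Definition pval (v : int) := forall n, n < v -> p n = 0.

Lemma vder_lower v N a : pval v ->
  (forall n, n < N -> a n = 0) -> forall n, n < N + (v - 1) -> vder a n = 0.
Proof.
move=> pv aN n nN; apply: (@lauM_lower _ v (N - 1)) => //; last by lia.
by move=> m mN; rewrite ldiffE aN ?mul0rz //; lia.
Qed.

(** D lowers the order in z by at most 1 - v, v the order of p. *)
Lemma flow_lower v N a k : pval v ->
  (forall n, n < N -> a n = 0) ->
  forall n, n < N + k * (v - 1) -> flow a k n = 0.
Proof.
move=> pv aN n nN; have [k0|] := ltP k 0; first by rewrite flow_neg.
case: k nN => // k nN _; rewrite flow_pos laucCM.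
suff -> : iter k vder a n = 0 by rewrite mulr0.
elim: k n nN => [|k IH] n nN; first by apply: aN; lia.
by rewrite iterS (@vder_lower v (N + k%:Z * (v - 1))) //; lia.
Qed.

(** * Reversing the flow *)

(** (-1)^j as a product of units, also for j < 0. *)
Definition zsign (j : int) : L1 := (-1) ^+ `|j|%N.

Lemma zsignS j : zsign (j + 1) = - zsign j.
Proof.
rewrite /zsign; have [j0|j0] := leP 0 j.
  by rewrite (_ : absz (j + 1) = (absz j).+1) ?exprS ?mulN1r //; lia.
by rewrite (_ : absz j = (absz (j + 1)).+1) ?exprS ?mulN1r ?opprK //; lia.
Qed.

Lemma zsignC j : exists c, zsign j = lcst c.
Proof.
rewrite /zsign -signr_odd; case: odd; last by exists 1.
by exists (-1); rewrite lcstN.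
Qed.

Lemma zsignM j : zsign j * zsign j = 1.
Proof. by rewrite /zsign -expr2 sqrr_sign. Qed.

Definition flip_fun x k : L1 :=
  \sum_(j \in [set: int]) zsign j * flow (x j) (k - j).

Lemma flip_term0 x N k j : (forall i, i < N -> x i = 0) ->
  (j < N) || (k < j) -> zsign j * flow (x j) (k - j) = 0.
Proof.
move=> x0 /orP[/x0->|kj]; first by rewrite flow_at0 mulr0.
by rewrite flow_neg ?mulr0 // subr_lt0.
Qed.

Lemma flip_fsup x k : fsup (fun j => zsign j * flow (x j) (k - j)).
Proof.
case: (lauP x) => N x0; apply: (@fsup_zint _ N k) => j jlt;
  apply: flip_term0 x0 _; by rewrite jlt ?orbT.
Qed.

Lemma flip_fun_lower x N : (forall i, i < N -> x i = 0) ->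
  forall k, k < N -> flip_fun x k = 0.
Proof.
move=> x0 k kN; apply: zsum0 => j; apply: flip_term0 x0 _.
by case: ltP => //= Nj; apply: lt_le_trans Nj.
Qed.

(** z0 to -z0 followed by exp(z0 D): the change of variables that exchanges the
    two points z and phi(z, z0). *)
Definition flip : L2 -> L2 := locked (fun x => mkl (flip_fun x)).

Lemma flipE x k : flip x k = \sum_(j \in [set: int]) zsign j * flow (x j) (k - j).
Proof.
rewrite /flip -lock; apply: mklE.
by case: (lauP x) => N x0; exists N; apply: flip_fun_lower.
Qed.

Lemma flip_lower x N : (forall i, i < N -> x i = 0) ->
  forall k, k < N -> flip x k = 0.
Proof. by move=> x0 k kN; rewrite flipE; apply: flip_fun_lower x0 _ _. Qed.

Lemma flip_first x N : (forall i, i < N -> x i = 0) -> flip x N = zsign N * x N.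
Proof.
move=> x0; rewrite flipE (@zsum1 _ N) ?subrr ?flow0 // => j jN.
by apply: flip_term0 x0 _; rewrite -neq_lt.
Qed.

Lemma flipD x y : flip (x + y) = flip x + flip y.
Proof.
apply: lau_eq => k; rewrite laucD !flipE -fsumD; [|exact: flip_fsup..].
by apply: eq_zsum => j; rewrite laucD flowD laucD mulrDr.
Qed.

Lemma flip_cst b x : flip (lcst b * x) = flow b * flip x.
Proof.
apply: lau_eq => k; rewrite flipE laucM; case: (lauP x) => N x0.
transitivity (\sum_(j \in [set: int]) \sum_(i \in [set: int])
    zsign j * (flow b i * flow (x j) (k - j - i))).
  apply: eq_zsum => j; rewrite laucCM flowM laucM.
  apply: (fsum_morph (h := fun t => zsign j * t)); last exact: conv_fsup.
  by move=> s t; rewrite mulrDr.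
rewrite (@fsum_exchange _ _ _ (zint N k) (zint 0 (k - N))); first last.
- move=> j i /notin_zint[i0|ki]; first by rewrite flow_neg // mul0r mulr0.
  have [/x0->|Nj] := ltP j N; first by rewrite flow_at0 lauc0 !mulr0.
  by rewrite [flow (x j) _]flow_neg ?mulr0 //; lia.
- move=> j i /notin_zint[/x0->|kj]; first by rewrite flow_at0 lauc0 !mulr0.
  have [i0|i0] := ltP i 0; first by rewrite flow_neg // mul0r mulr0.
  by rewrite [flow (x j) _]flow_neg ?mulr0 //; lia.
apply: eq_zsum => i; rewrite flipE.
rewrite (fsum_morph (h := fun t => flow b i * t)); first last.
- exact: flip_fsup.
- by move=> s t; rewrite mulrDr.
by apply: eq_zsum => j; rewrite mulrCA; congr (_ * (_ * flow _ _)); lia.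
Qed.

Lemma flip_lmap x : flip (lmap vder x) = lmap vder (flip x).
Proof.
apply: lau_eq => k; rewrite (lmapE vderD) !flipE (fsum_morph vderD); last first.
  exact: flip_fsup.
apply: eq_zsum => j; rewrite (lmapE vderD) -flow_lmap (lmapE vderD).
by have [c ->] := zsignC j; rewrite vderZ.
Qed.

(** Differentiating exp(z0 D) x(-z0) in z0. *)
Lemma flip_ldiff x : ldiff (flip x) = lmap vder (flip x) - flip (ldiff x).
Proof.
apply/eqP; rewrite eq_sym subr_eq eq_sym; apply/eqP.
apply: lau_eq => k; rewrite laucD ldiffE -flip_lmap !flipE.
case: (lauP x) => N x0.
rewrite [X in _ + X](fsum_shift (-1)).
rewrite (fsum_morph (h := fun t => t *~ (k + 1))); first last.
- exact: flip_fsup.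
- by move=> s t; rewrite mulrzDl.
rewrite -fsumD; first last.
- apply: (@fsup_zint _ N (k + 1)) => j jlt; rewrite ldiffE subrK.
    by rewrite x0 // mul0rz flow_at0 mulr0.
  by rewrite flow_neg ?mulr0 //; lia.
- apply: (@fsup_zint _ N (k + 1)) => j jlt.
    by rewrite x0 // flow_at0 lauc0 mulr0 mul0rz.
  by rewrite flow_neg ?mulr0 ?mul0rz //; lia.
apply: eq_zsum => j; rewrite (lmapE vderD) -flow_ldiff !ldiffE subrK.
have -> : zsign (j + -1) = - zsign j.
  by rewrite -{2}[j](subrK 1) zsignS opprK.
have -> : k - (j + -1) = k - j + 1 by lia.
rewrite (additiveMz flowD) lauc_mulz.
have -> : k + 1 - j = k - j + 1 by lia.
rewrite mulNr -mulrzAr -mulrBr -mulrNz -mulrzDr; congr (_ * (_ *~ _)).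
by lia.
Qed.

End Flow.

Section FlipInvolution.
Variable K : numFieldType.
Notation L1 := (lau K).
Notation L2 := (lau L1).
Variable p : L1.
Implicit Types (a b : L1) (x y : L2).
Local Notation J := (flip p).

Lemma zsignE j : zsign K j = (-1) ^ j.
Proof.
rewrite /zsign; case: j => j //.
by rewrite NegzE /= -exprnN -signr_odd invr_sign.
Qed.

Lemma zsignD i j : zsign K (i + j) = zsign K i * zsign K j.
Proof. by rewrite !zsignE expfzDr // oppr_eq0 oner_eq0. Qed.

Lemma flip_mono c x : J (lmono 1 c * x) = lmono (zsign K c) c * J x.
Proof.
apply: lau_eq => k; rewrite lauc_mono !flipE (fsum_shift c).
rewrite (fsum_morph (h := fun t => zsign K c * t)); first last.
- exact: flip_fsup.
- by move=> s t; rewrite mulrDr.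
apply: eq_zsum => j; rewrite lauc_mono mul1r addrK zsignD mulrA [_ c * _]mulrC.
by congr (_ * flow _ _ _); lia.
Qed.

(** The square of [flip] commutes with d/dz0 and fixes the term of degree 0 in
    z0, so it fixes all power series in z0; negative powers of z0 are removed
    by shifting. *)
Lemma flipK x : J (J x) = x.
Proof.
have ldJ y : ldiff (J (J y)) = J (J (ldiff y)).
  by rewrite flip_ldiff flip_ldiff (additiveB (flipD p)) flip_lmap opprB addrC subrK.
have reg y k : (forall i, i < 0 -> y i = 0) -> J (J y) k = y k.
  move=> y0; have [k0|] := ltP k 0.
    by rewrite y0 // (@flip_lower _ _ _ 0) // => i; apply: flip_lower.
  case: k => // k _; elim: k y y0 => [|k IH] y y0.
    rewrite !(@flip_first _ _ _ 0) ?mul1r //; exact: flip_lower.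
  have dy0 i : i < 0 -> ldiff y i = 0.
    move=> i0; rewrite ldiffE; have [->|i1] := eqVneq i (-1).
      by rewrite addNr mulr0z.
    by rewrite y0 ?mul0rz //; lia.
  have := congr1 (fun t : L2 => t k) (ldJ y).
  rewrite IH // !ldiffE -[1]/(1%:Z) -PoszD addn1 => /eqP.
  rewrite -subr_eq0 -mulrzBl => /eqP yk; apply/eqP; rewrite -subr_eq0; apply/eqP.
  by apply: lau_mulz_eq0 yk.
have JJmono c y : J (J (lmono 1 c * y)) = lmono 1 c * J (J y).
  have -> : J (lmono 1 c * y) = lcst (zsign K c) * (lmono 1 c * J y).
    by rewrite flip_mono mulrA lmonoM mulr1 add0r.
  have flz : flow p (zsign K c) * lmono (zsign K c) c = lmono 1 c.
    by have [s sE] := zsignC K c; rewrite sE flowC lmonoM add0r -sE zsignM.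
  by rewrite flip_cst flip_mono (mulrA (flow p (zsign K c))) flz.
case: (lauP x) => N x0; set y := lmono 1 (- N) * x.
have -> : x = lmono 1 N * y by rewrite mulrA lmonoM mulr1 subrr mul1r.
rewrite JJmono; congr (_ * _); apply: lau_eq => k; apply: reg => i i0.
by rewrite lauc_mono x0 ?mulr0 //; lia.
Qed.

Lemma flip_flow b x : J (flow p b * x) = lcst b * J x.
Proof. by rewrite -[x in LHS]flipK -flip_cst flipK. Qed.

End FlipInvolution.

(** * Restriction to the diagonal *)

Section DiagonalSum.
Variable K : numFieldType.
Notation L1 := (lau K).
Implicit Types (y : int -> L1) (b : L1).

Definition fam_below (N : int) y :=
  forall j n, (j < N) || (n < N) -> y j n = 0.

(** The value of y_j(z1) z2^j, summed over j, on the diagonal z1 = z2 = z. *)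
Definition dsum y : L1 :=
  mkl (fun n => \sum_(j \in [set: int]) y j (n - j)).

Lemma dsum_box N y n j : fam_below N y ->
  (j < N) || (n - N < j) -> y j (n - j) = 0.
Proof.
move=> yN /orP[jN|jN]; first by rewrite yN ?jN.
by apply: yN; apply/orP; right; lia.
Qed.

Lemma dsum_fsup N y n : fam_below N y -> fsup (fun j => y j (n - j)).
Proof.
by move=> yN; apply: (@fsup_zint _ N (n - N)) => j jlt;
  apply: dsum_box yN _; rewrite jlt ?orbT.
Qed.

Lemma dsumE N y n : fam_below N y ->
  dsum y n = \sum_(j \in [set: int]) y j (n - j).
Proof.
move=> yN; apply: mklE; exists (N + N) => m mN; apply: zsum0 => j.
by apply: dsum_box yN _; lia.
Qed.

Lemma eq_dsum y1 y2 : (forall j, y1 j = y2 j) -> dsum y1 = dsum y2.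
Proof. by move=> y12; congr dsum; apply: funext. Qed.

Lemma fam_belowM N M y b : fam_below N y -> (forall n, n < M -> b n = 0) ->
  fam_below (Order.min N (M + N)) (fun j => b * y j).
Proof.
move=> yN bM j n; rewrite !lt_min => /orP[|] /andP[lt1 lt2].
  have yj0 : y j = 0 by apply: lau_eq => m; rewrite yN ?lt1.
  by rewrite yj0 mulr0.
by apply: (lauM_lower bM _ lt2) => m mN; rewrite yN ?mN ?orbT.
Qed.

Lemma fam_belowD N M y1 y2 : fam_below N y1 -> fam_below M y2 ->
  fam_below (Order.min N M) (fun j => y1 j + y2 j).
Proof.
move=> yN yM j n; rewrite !lt_min laucD => lt1.
have [jN jM] : ((j < N) || (n < N)) /\ ((j < M) || (n < M)).
  by case/orP: lt1 => /andP[-> ->]; rewrite ?orbT.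
by rewrite yN ?yM ?addr0.
Qed.

Lemma dsumD N M y1 y2 : fam_below N y1 -> fam_below M y2 ->
  dsum (fun j => y1 j + y2 j) = dsum y1 + dsum y2.
Proof.
move=> yN yM; apply: lau_eq => n.
rewrite laucD (dsumE _ (fam_belowD yN yM)) (dsumE _ yN) (dsumE _ yM) -fsumD //.
  exact: dsum_fsup yN.
exact: dsum_fsup yM.
Qed.

Lemma dsumM N y b : fam_below N y -> dsum (fun j => b * y j) = b * dsum y.
Proof.
move=> yN; case: (lauP b) => M bM; apply: lau_eq => n.
rewrite laucM (dsumE _ (fam_belowM yN bM)).
transitivity (\sum_(j \in [set: int]) \sum_(i \in [set: int])
    b i * y j (n - i - j)).
  by apply: eq_zsum => j; rewrite laucM; apply: eq_zsum => i;
    congr (_ * y j _); lia.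
rewrite (@fsum_exchange _ _ _ (zint N (n - M - N)) (zint M (n - N - N))).
- apply: eq_zsum => i;
  rewrite (dsumE _ yN) (fsum_morph (h := fun t => b i * t)) //.
    by move=> s t; rewrite mulrDr.
  exact: dsum_fsup yN.
- move=> j i /notin_zint[jN|jN]; first by rewrite yN ?jN ?mulr0.
  have [/bM->|iM] := ltP i M; first by rewrite mul0r.
  by rewrite yN ?mulr0 //; lia.
- move=> j i /notin_zint[/bM->|iM]; first by rewrite mul0r.
  have [jN|jN] := ltP j N; first by rewrite yN ?jN ?mulr0.
  by rewrite yN ?mulr0 //; lia.
Qed.

Lemma dsum_mulz N y (k : int) : fam_below N y ->
  dsum (fun j => y j *~ k) = dsum y *~ k.
Proof.
move=> yN; transitivity (lcst k%:~R * dsum y); last first.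
  by apply: lau_eq => n; rewrite laucCM lauc_mulz mulrzl.
rewrite -(dsumM _ yN); apply: eq_dsum => j.
by apply: lau_eq => n; rewrite laucCM lauc_mulz mulrzl.
Qed.

Lemma dsum_fsum N (y : int -> int -> L1) (r : seq int) :
    (forall a, fam_below N (y a)) -> (forall a j, a \notin r -> y a j = 0) ->
  dsum (fun j => \sum_(a \in [set: int]) y a j)
  = \sum_(a \in [set: int]) dsum (y a).
Proof.
move=> yN yr.
have sumE j n : (\sum_(a \in [set: int]) y a j) n = \sum_(a \in [set: int]) y a j n.
  rewrite (fsum_morph (h := fun t : L1 => t n)) //.
  by exists r => a ar; apply: yr.
have yN' : fam_below N (fun j => \sum_(a \in [set: int]) y a j).
  by move=> j n jn; rewrite sumE; apply: zsum0 => a; apply: yN.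
have d0 : dsum (fun=> 0) = 0.
  by apply: lau_eq => n; rewrite (@dsumE 0) //; apply: zsum0 => j.
apply: lau_eq => n; rewrite (dsumE _ yN').
rewrite (fsum_morph (h := fun t : L1 => t n)) //; last first.
  by exists r => a ar; rewrite -d0; apply: eq_dsum => j; apply: yr.
transitivity (\sum_(j \in [set: int]) \sum_(a \in [set: int]) y a j (n - j)).
  by apply: eq_zsum => j; rewrite sumE.
rewrite (@fsum_exchange _ _ _ (zint N (n - N)) r).
- by apply: eq_zsum => a; rewrite (dsumE _ (yN a)).
- move=> j a /notin_zint jlt; apply: (dsum_box (yN a)).
  by case: jlt => ->; rewrite ?orbT.
- by move=> j a ar; rewrite yr.
Qed.

(** On the diagonal d/dz becomes the sum of the two partial derivatives. *)
Lemma ldiff_dsum N y : fam_below N y ->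
  ldiff (dsum y) = dsum (fun j => ldiff (y j)) + dsum (fun j => y (j + 1) *~ (j + 1)).
Proof.
move=> yN; apply: lau_eq => n.
have y1N : fam_below (N - 1) (fun j => ldiff (y j)).
  move=> j m jm; rewrite ldiffE yN ?mul0rz //.
  by case/orP: jm => lt1; apply/orP; [left|right]; lia.
have y2N : fam_below (N - 1) (fun j => y (j + 1) *~ (j + 1)).
  move=> j m jm; rewrite lauc_mulz yN ?mul0rz //.
  by case/orP: jm => lt1; apply/orP; [left|right]; lia.
rewrite laucD ldiffE (dsumE _ yN) (dsumE _ y1N) (dsumE _ y2N).
rewrite [X in _ = _ + X](fsum_shift (-1)).
rewrite (fsum_morph (h := fun t => t *~ (n + 1))); first last.
- exact: dsum_fsup yN.
- by move=> s t; rewrite mulrzDl.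
rewrite -fsumD; first last.
- apply: (@fsup_zint _ N (n + 1 - N)) => j jlt;
  rewrite lauc_mulz subrK yN ?mul0rz //.
    by rewrite jlt.
  by apply/orP; right; lia.
- exact: (dsum_fsup _ y1N).
apply: eq_zsum => j; rewrite lauc_mulz ldiffE subrK.
have -> : n + 1 - j = n - j + 1 by lia.
have -> : n - (j + -1) = n - j + 1 by lia.
by rewrite -mulrzDr; congr (_ *~ _); lia.
Qed.

End DiagonalSum.

(** * Series in two variables and the substitution z1 = phi(z2, z0) *)

Section DoubleSeries.
Variable K : numFieldType.
Notation L1 := (lau K).
Notation L2 := (lau L1).
Implicit Types (F G : int -> int -> K) (b : L1).

Definition bnd2 (N : int) F := forall m n, (m < N) || (n < N) -> F m n = 0.

Definition dlaurent F := exists N, bnd2 N F.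

Definition zcol F (n : int) : L1 := mkl (fun m => F m n).
Definition tr F : int -> int -> K := fun m n => F n m.
Definition mul1 b F : int -> int -> K := fun m n => (b * zcol F n) m.
Definition mul2 b F : int -> int -> K := tr (mul1 b (tr F)).
Definition d1 F : int -> int -> K := fun m n => F (m + 1) n *~ (m + 1).
Definition d2 F : int -> int -> K := tr (d1 (tr F)).

Lemma ext2 F G : (forall m n, F m n = G m n) -> F = G.
Proof. by move=> FG; apply: funext => m; apply: funext => n. Qed.

Lemma bnd2_le N M F : M <= N -> bnd2 N F -> bnd2 M F.
Proof. by move=> MN FN m n mn; apply: FN; lia. Qed.

Lemma zcolE N F n m : bnd2 N F -> zcol F n m = F m n.
Proof. by move=> FN; apply: mklE; exists N => i iN; rewrite FN ?iN. Qed.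

Lemma zcol0 N F n : bnd2 N F -> n < N -> zcol F n = 0.
Proof.
by move=> FN nN; apply: lau_eq => m; rewrite (zcolE _ _ FN) FN ?nN ?orbT.
Qed.

Lemma zcol_lower N F n m : bnd2 N F -> m < N -> zcol F n m = 0.
Proof. by move=> FN mN; rewrite (zcolE _ _ FN) FN ?mN. Qed.

Lemma bnd2_tr N F : bnd2 N F -> bnd2 N (tr F).
Proof. by move=> FN m n mn; apply: FN; rewrite orbC. Qed.

Lemma bnd2_mul1 N M b F : bnd2 N F -> (forall n, n < M -> b n = 0) ->
  bnd2 (Order.min N (M + N)) (mul1 b F).
Proof.
move=> FN bM m n; rewrite !lt_min => /orP[|] /andP[lt1 lt2].
  by apply: (lauM_lower bM _ lt2) => i iN; apply: zcol_lower FN iN.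
by rewrite /mul1 (zcol0 FN lt1) mulr0.
Qed.

Lemma bnd2_d1 N F : bnd2 N F -> bnd2 (N - 1) (d1 F).
Proof.
move=> FN m n mn; rewrite /d1 FN ?mul0rz //.
by case/orP: mn => lt1; apply/orP; [left|right]; lia.
Qed.

Lemma bnd2D N M F G : bnd2 N F -> bnd2 M G ->
  bnd2 (Order.min N M) (fun m n => F m n + G m n).
Proof.
move=> FN GM m n mn; rewrite (@bnd2_le _ (Order.min N M) _ _ FN) ?ge_min ?lexx //.
by rewrite (@bnd2_le _ (Order.min N M) _ _ GM) ?ge_min ?lexx ?orbT ?addr0.
Qed.

Lemma bnd2Z N c F : bnd2 N F -> bnd2 N (fun m n => c * F m n).
Proof. by move=> FN m n mn; rewrite FN // mulr0. Qed.

Lemma dlaurent_tr F : dlaurent F -> dlaurent (tr F).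
Proof. by case=> N FN; exists N; apply: bnd2_tr. Qed.
Lemma dlaurent_mul1 b F : dlaurent F -> dlaurent (mul1 b F).
Proof.
by case=> N FN; case: (lauP b) => M bM; exists (Order.min N (M + N));
  apply: bnd2_mul1.
Qed.
Lemma dlaurent_mul2 b F : dlaurent F -> dlaurent (mul2 b F).
Proof. by move=> dF; apply/dlaurent_tr/dlaurent_mul1/dlaurent_tr. Qed.
Lemma dlaurent_d1 F : dlaurent F -> dlaurent (d1 F).
Proof. by case=> N FN; exists (N - 1); apply: bnd2_d1. Qed.
Lemma dlaurent_d2 F : dlaurent F -> dlaurent (d2 F).
Proof. by move=> dF; apply/dlaurent_tr/dlaurent_d1/dlaurent_tr. Qed.
Lemma dlaurentD F G : dlaurent F -> dlaurent G ->
  dlaurent (fun m n => F m n + G m n).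
Proof. by case=> N FN [M GM]; exists (Order.min N M); apply: bnd2D. Qed.
Lemma dlaurentZ c F : dlaurent F -> dlaurent (fun m n => c * F m n).
Proof. by case=> N FN; exists N; apply: bnd2Z. Qed.

Lemma zcol_mul1 b F n : dlaurent F -> zcol (mul1 b F) n = b * zcol F n.
Proof.
by move=> dF; apply: lau_eq => m; have [N FN] := dlaurent_mul1 b dF;
  rewrite (zcolE _ _ FN).
Qed.

Lemma zcol_d1 F n : dlaurent F -> zcol (d1 F) n = ldiff (zcol F n).
Proof.
move=> [N FN]; apply: lau_eq => m.
by rewrite (zcolE _ _ (bnd2_d1 FN)) ldiffE (zcolE _ _ FN).
Qed.

Lemma zcolD F G n : dlaurent F -> dlaurent G ->
  zcol (fun m n => F m n + G m n) n = zcol F n + zcol G n.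
Proof.
move=> [N FN] [M GM]; apply: lau_eq => m.
by rewrite laucD (zcolE _ _ FN) (zcolE _ _ GM) (zcolE _ _ (bnd2D FN GM)).
Qed.

Section Substitution.
Variable p : L1.

(** The substitution z1 = phi(z2, z0): exp(z0 p(z1) d/dz1) is applied to each
    coefficient of a power of z2, and the result is restricted to the
    diagonal. *)
Definition phisub : (int -> int -> K) -> L2 :=
  locked (fun F => mkl (fun k => dsum (fun j => flow p (zcol F j) k))).

Lemma phisub_fam F k : dlaurent F -> exists N,
  fam_below N (fun j => flow p (zcol F j) k).
Proof.
move=> [N FN]; case: (lauP p) => v pv.
exists (Order.min N (N + k * (v - 1))) => j n; rewrite !lt_min.
case/orP=> /andP[lt1 lt2]; first by rewrite (zcol0 FN lt1) flow_at0.
by apply: (flow_lower pv) lt2 => i iN; apply: zcol_lower FN iN.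
Qed.

Lemma dsum0 : dsum (fun _ : int => 0 : L1) = 0.
Proof. by apply: lau_eq => n; rewrite (@dsumE _ 0) // zsum0. Qed.

Lemma phisubE F k : phisub F k = dsum (fun j => flow p (zcol F j) k).
Proof.
rewrite /phisub -lock;
  apply: (mklE (f := fun k => dsum (fun j => flow p (zcol F j) k))).
exists 0 => m m0; rewrite -dsum0; apply: eq_dsum => j; exact: flow_neg.
Qed.

Lemma phisub_neg F k : k < 0 -> phisub F k = 0.
Proof.
by move=> k0; rewrite phisubE -dsum0; apply: eq_dsum => j; apply: flow_neg.
Qed.

Lemma phisub_coef F k n : dlaurent F ->
  phisub F k n = \sum_(j \in [set: int]) flow p (zcol F j) k (n - j).
Proof.
by move=> dF; have [N fN] := phisub_fam k dF; rewrite phisubE (dsumE _ fN).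
Qed.

Lemma phisub_at0 F : phisub F 0 = dsum (zcol F).
Proof. by rewrite phisubE; apply: eq_dsum => j; rewrite flow0. Qed.

Lemma phisubD F G : dlaurent F -> dlaurent G ->
  phisub (fun m n => F m n + G m n) = phisub F + phisub G.
Proof.
move=> dF dG; apply: lau_eq => k; have [N FN] := phisub_fam k dF.
have [M GM] := phisub_fam k dG; rewrite laucD !phisubE -(dsumD FN GM).
by apply: eq_dsum => j; rewrite zcolD // flowD.
Qed.

Lemma phisub_mul1 b F : dlaurent F -> phisub (mul1 b F) = flow p b * phisub F.
Proof.
move=> dF; apply: lau_eq => k; rewrite laucM phisubE.
case: (lauP p) => v pv; case: (lauP b) => M bM; have [N FN] := dF.
have yN a : fam_below (Order.min N (M + N + k * (v - 1)))
    (fun j => flow p b a * flow p (zcol F j) (k - a)).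
  move=> j n; rewrite !lt_min => /orP[|] /andP[lt1 lt2].
    by rewrite (zcol0 FN lt1) flow_at0 mulr0.
  apply: (@lauM_lower _ (M + a * (v - 1)) (N + (k - a) * (v - 1))).
  - exact: (flow_lower pv).
  - by apply: (flow_lower pv) => i; apply: zcol_lower FN.
  - by rewrite mulrBl; lia.
have y0 a j : a \notin zint 0 k -> flow p b a * flow p (zcol F j) (k - a) = 0.
  move=> /notin_zint[a0|ka]; first by rewrite flow_neg ?mul0r.
  by rewrite [flow p (zcol F j) _]flow_neg ?mulr0 ?subr_lt0.
transitivity (dsum (fun j => \sum_(a \in [set: int])
    flow p b a * flow p (zcol F j) (k - a))).
  by apply: eq_dsum => j; rewrite zcol_mul1 // flowM laucM.
rewrite (dsum_fsum yN y0); apply: eq_zsum => a; rewrite phisubE.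
by have [N' FN'] := phisub_fam (k - a) dF; rewrite (dsumM _ FN').
Qed.

Lemma phisub_mul2 b F : dlaurent F -> phisub (mul2 b F) = lcst b * phisub F.
Proof.
move=> dF; have [N FN] := dF; case: (lauP b) => M bM.
have colE2 j : zcol (mul2 b F) j
    = \sum_(a \in [set: int]) lcst (b a) * zcol F (j - a).
  apply: lau_eq => m; have [N' FN'] := dlaurent_mul2 b dF.
  rewrite (zcolE _ _ FN') (fsum_morph (h := fun t : L1 => t m)) //; last first.
    apply: (@fsup_zint _ M (j - N)) => a alt; first by rewrite bM // lcst0 mul0r.
    by rewrite (zcol0 FN) ?mulr0 //; lia.
  rewrite /mul2 /tr /mul1 laucM; apply: eq_zsum => a.
  by rewrite laucCM (zcolE _ _ FN) (zcolE _ _ (bnd2_tr FN)).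
apply: lau_eq => k; have [N' yN] := phisub_fam k dF.
rewrite laucCM !phisubE; set y := fun j => _ in yN.
have flE j : flow p (zcol (mul2 b F) j) k
    = \sum_(a \in [set: int]) lcst (b a) * y (j - a).
  rewrite colE2 (fsum_morph (h := fun t : L1 => flow p t k)); first last.
  - apply: (@fsup_zint _ M (j - N)) => a alt; first by rewrite bM // lcst0 mul0r.
    by rewrite (zcol0 FN) ?mulr0 //; lia.
  - by move=> s t; rewrite flowD.
  by apply: eq_zsum => a; rewrite flow_lcst.
have flE2 j n : flow p (zcol (mul2 b F) j) k n
    = \sum_(a \in [set: int]) b a * y (j - a) n.
  rewrite flE (fsum_morph (h := fun t : L1 => t n)) //.
    by apply: eq_zsum => a; rewrite laucCM.
  apply: (@fsup_zint _ M (j - N)) => a alt; first by rewrite bM // lcst0 mul0r.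
  by rewrite /y (zcol0 FN) ?flow_at0 ?mulr0 //; lia.
apply: lau_eq => n; have [N2 FN2] := phisub_fam k (dlaurent_mul2 b dF).
rewrite (dsumE _ FN2) laucM.
transitivity (\sum_(j \in [set: int]) \sum_(a \in [set: int])
    b a * y (j - a) (n - j)); first by apply: eq_zsum => j; rewrite flE2.
rewrite (@fsum_exchange _ _ _ (zint (M + N') (n - N')) (zint M (n - N' - N'))).
- apply: eq_zsum => a; rewrite (dsumE _ yN) (fsum_shift a).
  rewrite (fsum_morph (h := fun t => b a * t)); first last.
  + exact: dsum_fsup yN.
  + by move=> s t; rewrite mulrDr.
  by apply: eq_zsum => j; rewrite addrK; congr (_ * y j _); lia.
- move=> j a /notin_zint jlt; have [/bM->|aM] := ltP a M; first by rewrite mul0r.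
  by rewrite yN ?mulr0 //; lia.
- move=> j a /notin_zint[/bM->|alt]; first by rewrite mul0r.
  by rewrite yN ?mulr0 //; lia.
Qed.

Lemma phisubZ c F : dlaurent F ->
  phisub (fun m n => c * F m n) = lcst (lcst c) * phisub F.
Proof.
move=> dF; rewrite -phisub_mul2 //; congr phisub; apply: ext2 => m n.
have [N FN] := dF.
by rewrite /mul2 /tr /mul1 laucCM (zcolE _ _ (bnd2_tr FN)).
Qed.

Lemma phisub_vder F : dlaurent F -> ldiff (phisub F) = phisub (mul1 p (d1 F)).
Proof.
move=> dF; apply: lau_eq => k; rewrite ldiffE !phisubE.
have [N FN] := phisub_fam (k + 1) dF; rewrite -(dsum_mulz _ FN).
apply: eq_dsum => j; rewrite zcol_mul1 ?zcol_d1 //; last exact: dlaurent_d1.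
by rewrite -/(vder p _) -flow_ldiff ldiffE.
Qed.

(** Chain rule: d phi/dz0 = p(phi). *)
Lemma phisub_ldiff F : dlaurent F -> ldiff (phisub F) = flow p p * phisub (d1 F).
Proof.
by move=> dF; rewrite phisub_vder // phisub_mul1 //; apply: dlaurent_d1.
Qed.

(** D on the diagonal is the sum of D1 = p(z1) d/dz1 and D2 = p(z2) d/dz2. *)
Lemma phisub_lmap F : dlaurent F -> lmap (vder p) (phisub F)
  = phisub (mul1 p (d1 F)) + phisub (mul2 p (d2 F)).
Proof.
move=> dF; rewrite phisub_mul2; last exact: dlaurent_d2.
apply: lau_eq => k; rewrite (lmapE (vderD p)) laucD laucCM !phisubE.
have [N yN] := phisub_fam k dF; rewrite /vder (ldiff_dsum yN) mulrDr.
congr (_ + _).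
  rewrite -(dsumM (N := N - 1)); last first.
    move=> j n jn; rewrite ldiffE yN ?mul0rz //.
    by case/orP: jn => lt1; apply/orP; [left|right]; lia.
  apply: eq_dsum => j; rewrite zcol_mul1 ?zcol_d1 //; last exact: dlaurent_d1.
  by rewrite -/(vder p _) -flow_lmap (lmapE (vderD p)).
congr (_ * _); apply: eq_dsum => j.
have -> : zcol (d2 F) j = zcol F (j + 1) *~ (j + 1).
  have [M FM] := dF; have [M' FM'] := dlaurent_d2 dF.
  by apply: lau_eq => m; rewrite (zcolE _ _ FM') lauc_mulz (zcolE _ _ FM).
by rewrite (additiveMz (@flowD _ p)) lauc_mulz.
Qed.

(** Substituting z1 = phi(z2, z0) and then exchanging the two points is the same
    as substituting z2 = phi(z1, z0).  Both sides have d/dz0 equal to the same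
    expression in D2 F, so induction on the power of z0, for all F at once,
    reduces to the term of degree 0, where both are the diagonal of F. *)
Lemma flip_phisub F : dlaurent F -> flip p (phisub F) = phisub (tr F).
Proof.
move=> dF; apply: lau_eq => k; have [k0|] := ltP k 0.
  by rewrite (phisub_neg _ k0) (@flip_lower _ _ _ 0) // => i; apply: phisub_neg.
case: k => // k _; elim: k F dF => [|k IH] F dF.
  rewrite (@flip_first _ _ _ 0); last by move=> i; apply: phisub_neg.
  rewrite mul1r !phisub_at0; have [N FN] := dF.
  have fN G : bnd2 N G -> fam_below N (zcol G).
    by move=> GN j n /orP[jN|nN]; rewrite ?(zcol0 GN jN) // (zcol_lower _ GN nN).
  apply: lau_eq => n; rewrite (dsumE _ (fN _ FN)) (dsumE _ (fN _ (bnd2_tr FN))).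
  rewrite (fsum_rev n); apply: eq_zsum => j.
  by rewrite subKr (zcolE _ _ FN) (zcolE _ _ (bnd2_tr FN)).
have ldL : ldiff (flip p (phisub F)) = flip p (phisub (mul2 p (d2 F))).
  by rewrite flip_ldiff -flip_lmap phisub_lmap // flipD phisub_vder // addrAC subrr add0r.
have ldR : ldiff (phisub (tr F)) = phisub (tr (mul2 p (d2 F))).
  by rewrite phisub_vder //; apply: dlaurent_tr.
have /eqP := IH (mul2 p (d2 F)) (dlaurent_mul2 p (dlaurent_d2 dF)).
rewrite -ldL -ldR !ldiffE -[1]/(1%:Z) -PoszD addn1 -subr_eq0 -mulrzBl => /eqP e.
by apply/eqP; rewrite -subr_eq0; apply/eqP; apply: lau_mulz_eq0 e.
Qed.

End Substitution.
End DoubleSeries.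

Section Injectivity.
Variable K : numFieldType.
Notation L1 := (lau K).
Notation L2 := (lau L1).
Implicit Types (F : int -> int -> K) (a b : L1).
Variables (p : L1) (v : int).
Hypotheses (pv : pval p v) (pn0 : p v != 0).

(** D^k z^N has lowest coefficient (p v)^k times the value of this polynomial at
    N, where v is the order of p. *)
Definition step_poly (k : nat) : {poly K} := \prod_(l < k) ('X + ((v - 1) *+ l)%:~R%:P).

Lemma vder_lead a N : (forall n, n < N -> a n = 0) ->
  vder p a (N + (v - 1)) = p v * N%:~R * a N.
Proof.
move=> aN; rewrite (_ : N + (v - 1) = v + (N - 1)); last by lia.
rewrite lau_lead //; last by move=> n nN; rewrite ldiffE aN ?mul0rz //; lia.
by rewrite ldiffE subrK -mulrA mulrzl.
Qed.

Lemma flow_lead a N (k : nat) : (forall n, n < N -> a n = 0) ->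
  flow p a k (N + k%:Z * (v - 1))
  = k`!%:R^-1 * p v ^+ k * (step_poly k).[N%:~R] * a N.
Proof.
move=> aN; rewrite flow_pos laucCM -!mulrA; congr (_ * _).
have low m n : n < N + m%:Z * (v - 1) -> iter m (vder p) a n = 0.
  elim: m n => [|m IH] n nlt; first by apply: aN; lia.
  by rewrite iterS (@vder_lower _ _ v (N + m%:Z * (v - 1))) //; lia.
elim: k => [|k IH]; first by rewrite mul0r addr0 /step_poly big_ord0 hornerC !mul1r.
rewrite iterS (_ : N + _ = N + k%:Z * (v - 1) + (v - 1)); last by lia.
rewrite vder_lead; last exact: low.
rewrite IH /step_poly big_ord_recr /= hornerM hornerD hornerX hornerC exprS.
rewrite (_ : (N + k%:Z * (v - 1))%:~R = N%:~R + ((v - 1) *+ k)%:~R :> K).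
  by ring.
by rewrite -intrD -mulr_natl natz.
Qed.

Lemma size_step_poly k : size (step_poly k) = k.+1.
Proof.
rewrite /step_poly (eq_bigr (fun l : 'I_k => 'X - (- ((v - 1) *+ l)%:~R)%:P)).
  by rewrite size_prod_XsubC /index_enum -enumT size_enum_ord.
by move=> l _; rewrite polyCN opprK.
Qed.

(** There is one such polynomial in each degree, so they span all
    polynomials. *)
Lemma step_poly_span (L : {poly K} -> K) :
    (forall P Q, L (P + Q) = L P + L Q) -> (forall c P, L (c *: P) = c * L P) ->
  (forall k, L (step_poly k) = 0) -> forall P, L P = 0.
Proof.
move=> LD LZ L0 P; have [n] := ubnP (size P); elim: n P => // n IH P Pn.
have [->|P0] := eqVneq P 0.
  by have := LZ 0 (step_poly 0); rewrite scale0r mul0r.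
(* Subtracting c times step polynomial k removes the leading term of P. *)
pose k := (size P).-1; pose c := lead_coef P / lead_coef (step_poly k).
have fk0 : step_poly k != 0 by rewrite -size_poly_gt0 size_step_poly.
have c0 : c != 0 by rewrite mulf_neq0 ?invr_eq0 ?lead_coef_eq0.
have -> : P = (P - c *: step_poly k) + c *: step_poly k by rewrite subrK.
rewrite LD LZ L0 mulr0 addr0 IH //.
have szP : (0 < size P)%N by rewrite size_poly_gt0.
have szk : size (c *: step_poly k) = size P by rewrite size_scale // size_step_poly prednK.
suff lt1 : (size (P - c *: step_poly k)%R < size P)%N by apply: leq_trans lt1 Pn.
rewrite -[X in (_ < X)%N]prednK // ltnS.
apply/leq_sizeP => j; rewrite leq_eqVlt => /orP[/eqP<-|lt1].
  rewrite coefB coefZ -/k.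
  have -> : P`_k = lead_coef P by [].
  have -> : (step_poly k)`_k = lead_coef (step_poly k) by rewrite lead_coefE size_step_poly.
  by rewrite divfK ?subrr // lead_coef_eq0.
have sj : (size P <= j)%N by rewrite -(prednK szP).
by rewrite coefB !nth_default ?subrr ?szk.
Qed.

(** Let F vanish in total degree below D.  The lowest term of coefficient k of
    the image of F is, up to a unit, the sum over i + j = D of F i j times the
    k-th step polynomial at i.  If the image is 0, then so is the sum of
    F i j P(i) for every polynomial P, and a P that vanishes at all but one of
    the finitely many i isolates a single coefficient of F. *)
Lemma phisub_inj0 F : dlaurent F -> phisub p F = 0 -> forall m n, F m n = 0.
Proof.
move=> dF TF0; have [N FN] := dF.
suff main (d : nat) : forall m n : int, m + n < N + N + d%:Z -> F m n = 0.
  by move=> m n; apply: (main (absz (m + n - N - N + 1))); lia.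
elim: d => [|d IH] m n mn; first by apply: FN; lia.
have [/IH//|mn'] := ltP (m + n) (N + N + d%:Z).
pose D : int := N + N + d%:Z.
pose L (P : {poly K}) := \sum_(j <- zint N (D - N)) P.[(D - j)%:~R] * F (D - j) j.
have LP : forall P, L P = 0.
  apply: step_poly_span => [P Q|c P|k].
  - by rewrite /L -big_split; apply: eq_bigr => j _; rewrite hornerD mulrDl.
  - by rewrite /L mulr_sumr; apply: eq_bigr => j _; rewrite hornerZ mulrA.
  have := congr1 (fun x : L2 => x k (D + k%:Z * (v - 1))) TF0.
  rewrite !lauc0 phisub_coef // => TD.
  have term (j : int) : flow p (zcol F j) k (D + k%:Z * (v - 1) - j)
      = k`!%:R^-1 * p v ^+ k * ((step_poly k).[(D - j)%:~R] * F (D - j) j).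
    rewrite (_ : D + _ - j = D - j + k%:Z * (v - 1)); last by lia.
    rewrite flow_lead => [|i iD]; first by rewrite (zcolE _ _ FN) -mulrA.
    by rewrite (zcolE _ _ FN); apply: IH; rewrite -/D; lia.
  have c0 : k`!%:R^-1 * p v ^+ k != 0.
    by rewrite mulf_neq0 ?expf_neq0 // invr_eq0 pnatr_eq0 -lt0n fact_gt0.
  apply: (mulfI c0); rewrite mulr0 -[RHS]TD /L mulr_sumr.
  rewrite (@fsumE _ _ (zint N (D - N))).
  - by apply: eq_bigr => j _; rewrite term.
  - rewrite map_inj_uniq ?iota_uniq // => i j /addrI; by case.
  - move=> j jn; rewrite term FN ?mulr0 //.
    by case/notin_zint: jn => lt1; lia.
pose Q : {poly K} :=
  \prod_(i <- [seq i <- zint N (D - N) | i != n]) ('X - (D - i)%:~R%:P).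
have mD : m = D - n by rewrite /D; lia.
have [nN|nN] := ltP n N; first by rewrite FN ?nN ?orbT.
have [nDN|nDN] := ltP (D - N) n.
  by rewrite FN //; apply/orP; left; lia.
have uz : uniq (zint N (D - N)).
  by rewrite map_inj_uniq ?iota_uniq // => i j /addrI; case.
have := LP Q; rewrite /L (bigD1_seq n) ?mem_zint //.
rewrite big1_seq ?addr0 => [|j /andP[jn jz]]; last first.
  rewrite /Q horner_prod (big_rem j); last by rewrite mem_filter jn.
  by rewrite /= hornerXsubC subrr !mul0r.
move=> /= /eqP; rewrite ?addr0 mulf_eq0 -mD => /orP[|/eqP//].
rewrite /Q horner_prod prodf_seq_eq0 => /hasP[j];
  rewrite mem_filter => /andP[i_n _].
rewrite hornerXsubC subr_eq0 mD => /eqP/intr_inj mDi.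
by case/eqP: i_n; lia.
Qed.

Lemma phisub_inj F G : dlaurent F -> dlaurent G -> phisub p F = phisub p G -> F = G.
Proof.
move=> dF dG FG; apply: ext2 => m n; apply/eqP; rewrite -subr_eq0; apply/eqP.
have dNG := dlaurentZ (- 1) dG.
rewrite -mulN1r.
apply: (@phisub_inj0 (fun m n => F m n + -1 * G m n)); first exact: dlaurentD.
by rewrite phisubD // phisubZ // FG !lcstN mulN1r subrr.
Qed.

End Injectivity.

Section Regular.
Variable R : fieldType.
Implicit Types x y : lau R.

(** The inverse of a series of order N has order - N. *)
Lemma lau_inv_lower x (N : int) : (forall n, n < N -> x n = 0) -> x N != 0 ->
  forall n : int, n < - N -> x^-1 n = 0.
Proof.
move=> xN xN0 n nN; have x0 : x != 0 by apply: contraNneq xN0 => ->.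
have [M [xM xM0]] : exists M, x^-1 M != 0 /\ forall n, n < M -> x^-1 n = 0.
  by apply: lau_valP; rewrite invr_eq0.
have := lau_lead xN xM0; rewrite divff // lauc1.
case: eqP => [NM _|_ /esym/eqP]; first by apply: xM0; lia.
by rewrite mulf_eq0 (negPf xN0) (negPf xM).
Qed.

Lemma lau_prod_first (I : Type) (r : seq I) (f : I -> lau R) :
    (forall i n, n < 0 -> f i n = 0) ->
  (forall n, n < 0 -> (\prod_(i <- r) f i) n = 0)
  /\ (\prod_(i <- r) f i) 0 = \prod_(i <- r) f i 0.
Proof.
move=> f0; elim: r => [|i r [IH1 IH2]].
  by rewrite !big_nil; split=> // n n0; rewrite lauc1 lt_eqF.
rewrite !big_cons; split.
  by move=> n n0; apply: (lauM_lower (f0 i) IH1); rewrite addr0.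
by have := lau_lead (f0 i) IH1; rewrite addr0 IH2.
Qed.

End Regular.

(** * Residues of fractions *)

Section FractionIdentities.
Variable R : fieldType.
Implicit Types a b q t w x y z : R.

Lemma partial_fraction q a b w x : q != 0 -> x - a != 0 -> x - b != 0 ->
  (a - b) * (w / ((x - a) * ((x - b) * q)))
  = w / ((x - a) * q) - w / ((x - b) * q).
Proof. by move=> nq na nb; field; rewrite nq na nb. Qed.

Lemma derivative_inv t w y : t != 0 -> y != 0 ->
  - ((y * t)^-1 * (t * w)) = - (y * t)^-1 * w / y * (y * t).
Proof. by move=> nt ny; field; rewrite nt ny. Qed.

Lemma derivative_frac t z w x y : t != 0 -> z != 0 -> y != 0 ->
  z * x * (- t^-1 * (w / z) / y) = - (w * x / (y * t)).
Proof. by move=> nt nz ny; field; rewrite nt nz ny. Qed.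

End FractionIdentities.

Section Residues.
Variable K : numFieldType.
Notation L1 := (lau K).
Notation L2 := (lau L1).
Implicit Types (F G : int -> int -> K) (s : seq K) (c e : K).

Definition kcst (c : K) : L2 := lcst (lcst c).
Definition zvar : L1 := lmono 1 1.

Lemma kcst1 : kcst 1 = 1. Proof. by []. Qed.
Lemma kcstB c e : kcst (c - e) = kcst c - kcst e.
Proof. by rewrite /kcst !lcstD !lcstN. Qed.
Lemma kcst_eq0 c : (kcst c == 0) = (c == 0).
Proof. by rewrite /kcst !lcst_eq0. Qed.

Lemma ldiff_zvar : ldiff zvar = 1.
Proof.
apply: lau_eq => n; rewrite ldiffE laucE lauc1 -subr_eq0 addrK.
by case: eqP => [->|_]; rewrite ?mul0rz.
Qed.

Lemma zvar_neq0 : zvar != 0.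
Proof.
apply/eqP => /(congr1 (fun x : L1 => x 1)); rewrite laucE eqxx lauc0 => /eqP.
by rewrite oner_eq0.
Qed.

(** What the residue calculus uses about an expansion of K((z1, z2)): the
    expansion map rho, the images xi of z1/z2 and zeta of z2, a derivation d
    playing the role of d/dt for a parameter t of the domain, omega = dz1/dt,
    and a residue that kills derivatives.  Three instances follow: the domains
    |z1| > |z2| and |z2| > |z1|, and the punctured neighbourhood of
    z1 = e z2. *)
Record realization (rho : (int -> int -> K) -> L2) (xi zeta omega : L2)
    (d : L2 -> L2) (res : L2 -> L1) : Prop := Realization {
  rz_resD : forall x y, res (x + y) = res x + res y;
  rz_resZ : forall c x, res (kcst c * x) = lcst c * res x;
  rz_dD : forall x y, d (x + y) = d x + d y;
  rz_dM : forall x y, d (x * y) = d x * y + x * d y;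
  rz_dC : forall c, d (kcst c) = 0;
  rz_res_d : forall x, res (d x) = 0;
  rz_omega : omega != 0;
  rz_xi : zeta * d xi = omega;
  rz_rho_d : forall F, dlaurent F -> d (rho F) = omega * rho (d1 F);
  rz_rho_z : forall F, dlaurent F -> rho (mul2 zvar F) = zeta * rho F
}.

Definition qval (xi : L2) s : L2 := \prod_(c <- s) (xi - kcst c).

Section OneRealization.
Variables (rho : (int -> int -> K) -> L2) (xi zeta omega : L2).
Variables (d : L2 -> L2) (res : L2 -> L1).
Hypothesis rz : realization rho xi zeta omega d res.

(** The residue of F / Q(z1/z2) dz1, where s lists the roots of Q. *)
Definition frac_res F s : L1 := res (omega * rho F / qval xi s).

Lemma rz_neq0 c : xi - kcst c != 0.
Proof.
apply: contraNneq (rz_omega rz) => xic.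
rewrite -(rz_xi rz); have -> : d xi = d (xi - kcst c).
  by rewrite (additiveB (rz_dD rz)) (rz_dC rz) subr0.
by rewrite xic (additive0 (rz_dD rz)) mulr0.
Qed.

Lemma qval_neq0 s : qval xi s != 0.
Proof. by rewrite prodf_seq_neq0; apply/allP => c _; apply: rz_neq0. Qed.

Lemma zeta_neq0 : zeta != 0.
Proof.
by apply: contraNneq (rz_omega rz) => z0; rewrite -(rz_xi rz) z0 mul0r.
Qed.

(** Partial fractions for two distinct roots. *)
Lemma frac_res_split F c e s : c != e ->
  lcst (c - e) * frac_res F [:: c, e & s]
  = frac_res F (c :: s) - frac_res F (e :: s).
Proof.
move=> ce; rewrite /frac_res -(rz_resZ rz) -(additiveB (rz_resD rz)).
congr res; rewrite /qval !big_cons -/(qval xi s) kcstB.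
exact: (partial_fraction _ (qval_neq0 s) (rz_neq0 c) (rz_neq0 e)).
Qed.

Lemma rz_dX x n : d (x ^+ n.+1) = x ^+ n * d x *+ n.+1.
Proof.
elim: n => [|n IH]; first by rewrite expr1 expr0 mul1r.
by rewrite exprS (rz_dM rz) IH mulrnAr mulrA -exprS [d x * _]mulrC -mulrS.
Qed.

(** A pole of order k + 2 is traded for one of order k + 1: the derivative of
    z2 F / (z1/z2 - c)^(k+1) has no residue. *)
Lemma frac_res_power F c k : dlaurent F ->
  frac_res F (nseq k.+2 c) *+ k.+1
  = frac_res (d1 (mul2 zvar F)) (nseq k.+1 c).
Proof.
move=> dF; have dG : dlaurent (mul2 zvar F) by apply: dlaurent_mul2.
pose y := xi - kcst c; have y0 : y != 0 by apply: rz_neq0.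
have qE n : qval xi (nseq n c) = y ^+ n.
  by rewrite /qval big_nseq; elim: n => //= n ->; rewrite exprS.
have dy : d y = omega / zeta.
  apply: (mulfI zeta_neq0); rewrite (additiveB (rz_dD rz)) (rz_dC rz) subr0.
  by rewrite (rz_xi rz) mulrC divfK ?zeta_neq0.
have yk0 : y ^+ k.+1 != 0 by rewrite expf_neq0.
have dV : d (y ^+ k.+1)^-1 = - (y ^+ k.+1)^-1 * (d y *+ k.+1) / y.
  have : d ((y ^+ k.+1)^-1 * y ^+ k.+1) = 0.
    by rewrite mulVf // -kcst1 (rz_dC rz).
  rewrite (rz_dM rz) rz_dX => /eqP; rewrite addr_eq0 => /eqP dV.
  by apply: (mulIf yk0); rewrite dV exprS -mulrnAr derivative_inv ?expf_neq0.
have := rz_res_d rz (rho (mul2 zvar F) / y ^+ k.+1).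
rewrite (rz_dM rz) (rz_rho_d rz dG) dV (rz_rho_z rz dF) dy.
have -> : zeta * rho F * (- (y ^+ k.+1)^-1 * ((omega / zeta) *+ k.+1) / y)
    = - ((omega * rho F / y ^+ k.+2) *+ k.+1).
  rewrite mulrnAr mulrnAl mulrnAr -mulNrn; congr (_ *+ _).
  by rewrite [y ^+ k.+2]exprS derivative_frac ?zeta_neq0.
rewrite (additiveB (rz_resD rz)) => /eqP; rewrite subr_eq0 => /eqP resE.
by rewrite /frac_res !qE resE !pmulrn (additiveMz (rz_resD rz)).
Qed.

Lemma frac_res_perm F s1 s2 : perm_eq s1 s2 -> frac_res F s1 = frac_res F s2.
Proof. by move=> ss; rewrite /frac_res /qval (perm_big _ ss). Qed.

End OneRealization.

(** The expansion in the domain |z1| > |z2|: z2 is the outer variable. *)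
Definition rho12 F : L2 := mkl (fun n => zcol F n).
Definition xi12 : L2 := lcst zvar * lmono 1 (-1).
Definition res12 (x : L2) : L1 := mkl (fun n => x n (-1)).

Lemma rho12E F n : dlaurent F -> rho12 F n = zcol F n.
Proof.
case=> N FN; apply: (mklE (f := fun n => zcol F n)); exists N => m mN.
exact: zcol0 FN mN.
Qed.

Lemma res12E x n : res12 x n = x n (-1).
Proof.
apply: (mklE (f := fun n => x n (-1))); case: (lauP x) => N x0.
by exists N => m /x0 ->.
Qed.

Lemma realization12 : realization rho12 xi12 (lmono 1 1) 1
  (lmap (@ldiff K)) res12.
Proof.
split=> [x y|c x|x y|x y|c|x|||F dF|F dF].
- by apply: lau_eq => n; rewrite laucD !res12E.
- by apply: lau_eq => n; rewrite laucCM !res12E !laucCM.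
- exact: lmapD (@ldiffD K) _ _.
- exact: lmapM (@ldiffD K) (@ldiffM K) _ _.
- by rewrite lmapC ?ldiffC ?lcst0 //; apply: ldiffD.
- by apply: lau_eq => n; rewrite res12E (lmapE (@ldiffD K)) ldiffE addNr mulr0z.
- exact: oner_neq0.
- have ldm : lmap (@ldiff K) (lmono 1 (-1)) = 0.
    apply: lau_eq => n; rewrite (lmapE (@ldiffD K)) laucE lauc0.
    by case: eqP => _; [exact: ldiffC|exact: (additive0 (@ldiffD K))].
  rewrite (lmapM (@ldiffD K) (@ldiffM K)) ldm mulr0 addr0.
  by rewrite (lmapC (@ldiffD K)) ldiff_zvar lcst1 mul1r lmonoM mulr1 subrr.
- rewrite mul1r; apply: lau_eq => n; rewrite (lmapE (@ldiffD K)).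
  by rewrite !rho12E ?zcol_d1 //; apply: dlaurent_d1.
- apply: lau_eq => n; rewrite lauc_mono mul1r !rho12E //;
  last exact: dlaurent_mul2.
  have [N FN] := dF; have [M FM] := dlaurent_mul2 zvar dF.
  apply: lau_eq => m; rewrite (zcolE _ _ FM) (zcolE _ _ FN).
  by rewrite /mul2 /tr /mul1 lauc_mono mul1r (zcolE _ _ (bnd2_tr FN)).
Qed.

(** The expansion in the domain |z2| > |z1|: z1 is the outer variable. *)
Definition rho21 F : L2 := rho12 (tr F).
Definition xi21 : L2 := lmono 1 1 * lcst zvar^-1.
Definition res_outer (x : L2) : L1 := x (-1).

Lemma res_outer_ldiff x : res_outer (ldiff x) = 0.
Proof. by rewrite /res_outer ldiffE addNr mulr0z. Qed.

Lemma ldiff_lmono1 : ldiff (lmono 1 1 : L2) = 1.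
Proof.
apply: lau_eq => n; rewrite ldiffE laucE lauc1 -subr_eq0 addrK.
by case: eqP => [->|_]; rewrite ?mul0rz.
Qed.

Lemma realization21 : realization rho21 xi21 (lcst zvar) 1 (@ldiff L1) res_outer.
Proof.
split=> [x y|c x|x y|x y|c|x|||F dF|F dF].
- by [].
- by rewrite /res_outer laucCM.
- exact: ldiffD.
- exact: ldiffM.
- exact: ldiffC.
- exact: res_outer_ldiff.
- exact: oner_neq0.
- rewrite /xi21 ldiffM ldiffC mulr0 addr0 ldiff_lmono1 mul1r -lcstM.
  by rewrite divff ?zvar_neq0.
- have dt := dlaurent_tr dF; have dt1 := dlaurent_tr (dlaurent_d1 dF).
  rewrite mul1r; apply: lau_eq => n; rewrite ldiffE !rho12E //.
  have [N FN] := dt; have [M FM] := dt1.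
  by apply: lau_eq => m; rewrite lauc_mulz (zcolE _ _ FN) (zcolE _ _ FM).
- have dt := dlaurent_tr dF; have dt1 := dlaurent_tr (dlaurent_mul2 zvar dF).
  by apply: lau_eq => n; rewrite laucCM !rho12E // zcol_mul1.
Qed.

(** F(e z1, z2). *)
Definition scale1 e F : int -> int -> K := fun m n => e ^ m * F m n.

Lemma dlaurent_scale1 e F : dlaurent F -> dlaurent (scale1 e F).
Proof. by case=> N FN; exists N => m n mn; rewrite /scale1 FN ?mulr0. Qed.

Section AtPoint.
Variables (p : L1) (p0 : p != 0).

Definition phi0 : L2 := flow p zvar.
(** The expansion near z1 = e z2, through z1 = e phi(z2, z0). *)
Definition rho_at e F : L2 := phisub p (scale1 e F).
Definition xi_at e : L2 := kcst e * (phi0 * lcst zvar^-1).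
Definition omega_at e : L2 := kcst e * flow p p.

Lemma ldiff_phi0 : ldiff phi0 = flow p p.
Proof. by rewrite flow_ldiff /vder ldiff_zvar mulr1. Qed.

Lemma flow_neq0 a : a != 0 -> flow p a != 0.
Proof.
move=> a0; apply: contraNneq a0 => fa; rewrite -(flow0 p a) fa.
by rewrite lauc0.
Qed.

Lemma realization_at e : e != 0 ->
  realization (rho_at e) (xi_at e) (lcst zvar) (omega_at e) (@ldiff L1) res_outer.
Proof.
move=> e0; split=> [x y|c x|x y|x y|c|x|||F dF|F dF].
- by [].
- by rewrite /res_outer laucCM.
- exact: ldiffD.
- exact: ldiffM.
- exact: ldiffC.
- exact: res_outer_ldiff.
- by rewrite mulf_neq0 ?kcst_eq0 ?flow_neq0.
- rewrite /xi_at ldiffM ldiffC mul0r add0r ldiffM ldiffC mulr0 addr0 ldiff_phi0.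
  rewrite mulrCA; congr (_ * _); rewrite mulrCA -lcstM divff ?zvar_neq0 //.
  by rewrite lcst1 mulr1.
- rewrite /rho_at phisub_ldiff; last exact: dlaurent_scale1.
  rewrite /omega_at -mulrA mulrCA; congr (_ * _).
  rewrite -phisubZ; last by apply/dlaurent_scale1/dlaurent_d1.
  congr phisub; apply: ext2 => m n; rewrite /d1 /scale1 mulrA -mulrzAr.
  by rewrite -[X in X * _ ^ _]expr1z -expfzDr // [1 + m]addrC.
- rewrite /rho_at -phisub_mul2; last exact: dlaurent_scale1.
  congr phisub; apply: ext2 => m n; have [N FN] := dF.
  have [M FM] := dlaurent_scale1 e dF.
  rewrite /scale1 /mul2 /tr /mul1 !lauc_mono !mul1r.
  by rewrite (zcolE _ _ (bnd2_tr FN)) (zcolE _ _ (bnd2_tr FM)).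
Qed.

Definition res_at e F s := frac_res (rho_at e) (xi_at e) (omega_at e) res_outer F s.

Lemma xi_atE e n : xi_at e n = lcst e * (zvar^-1 * phi0 n).
Proof. by rewrite /xi_at /kcst [phi0 * _]mulrC !laucCM. Qed.

Lemma xi_at_neg e c n : n < 0 -> (xi_at e - kcst c) n = 0.
Proof.
move=> n0; rewrite laucB xi_atE /phi0 flow_neg // !mulr0 /kcst laucC.
by rewrite lt_eqF // subr0.
Qed.

Lemma xi_at_0 e c : (xi_at e - kcst c) 0 = lcst (e - c).
Proof.
rewrite laucB xi_atE /phi0 flow0 mulVf ?zvar_neq0 // mulr1 /kcst laucC eqxx.
by rewrite lcstD lcstN.
Qed.

Lemma xi_at_1 e c : (xi_at e - kcst c) 1 = lcst e * (zvar^-1 * p).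
Proof.
rewrite laucB xi_atE /phi0 (flow_pos _ _ 1) invr1 mul1r.
by rewrite [iter _ _ _]/(vder p zvar) /vder ldiff_zvar mulr1 /kcst laucC subr0.
Qed.

Lemma omega_rho_neg e F n : n < 0 -> (omega_at e * rho_at e F) n = 0.
Proof.
move=> n0; apply: (@lauM_lower _ 0 0) => //; last by move=> m; apply: phisub_neg.
by move=> m m0; rewrite /omega_at /kcst laucCM flow_neg ?mulr0.
Qed.

Lemma omega_rho_0 e F :
  (omega_at e * rho_at e F) 0 = lcst e * p * dsum (zcol (scale1 e F)).
Proof.
rewrite -[0 in LHS]addr0 lau_lead.
- by rewrite /omega_at /kcst laucCM flow0 /rho_at phisub_at0.
- by move=> m m0; rewrite /omega_at /kcst laucCM flow_neg ?mulr0.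
- by move=> m; apply: phisub_neg.
Qed.

Lemma frac_at_regular e F s : e \notin s ->
  forall n, n < 0 -> (omega_at e * rho_at e F / qval (xi_at e) s) n = 0.
Proof.
move=> es n n0.
have [q0 qE] := lau_prod_first s (fun c n n0 => xi_at_neg e c n0).
apply: (@lauM_lower _ 0 0) => //; first by move=> m; apply: omega_rho_neg.
move=> m m0; apply: (@lau_inv_lower _ _ 0) => //; rewrite ?oppr0 //.
rewrite qE prodf_seq_neq0; apply/allP => c cs; rewrite xi_at_0 lcst_eq0 subr_eq0.
by apply: contraNneq es => ->.
Qed.

(** There is no pole at a point that is not a root. *)
Lemma res_at_regular e F s : e \notin s -> res_at e F s = 0.
Proof. by move=> es; apply: frac_at_regular. Qed.

(** Simple pole: e phi/z2 - e has order 1 in z0 with coefficient e p(z2)/z2,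
    and dz1/dz0 starts with e p(z2), so the residue is z2 F(e z2, z2) with no
    dependence on p. *)
Lemma res_at_simple c F : c != 0 ->
  res_at c F [:: c] = zvar * dsum (zcol (scale1 c F)).
Proof.
move=> c0; rewrite /res_at /frac_res /qval big_seq1 /res_outer.
have y1 : forall n, n < 1 -> (xi_at c - kcst c) n = 0.
  move=> n n1; have [n0|n0] := ltP n 0; first exact: xi_at_neg.
  by rewrite (_ : n = 0) ?xi_at_0 ?subrr ?lcst0 //; lia.
have y1n0 : (xi_at c - kcst c) 1 != 0.
  by rewrite xi_at_1 !mulf_neq0 ?invr_eq0 ?lcst_eq0 ?zvar_neq0.
have y0 : xi_at c - kcst c != 0 by apply: contraNneq y1n0 => ->.
set u := omega_at c * rho_at c F / (xi_at c - kcst c).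
have uy : u * (xi_at c - kcst c) = omega_at c * rho_at c F by rewrite divfK.
have um : forall n, n < -1 -> u n = 0.
  move=> n n1; apply: (@lauM_lower _ 0 (-1)) => //.
    by move=> m; apply: omega_rho_neg.
  by move=> m m1; apply: (lau_inv_lower y1 y1n0).
have := congr1 (fun x : L2 => x 0) uy; rewrite omega_rho_0.
rewrite -[0 in X in X -> _](addNr 1) (lau_lead um y1) xi_at_1.
have cp0 : lcst c * p != 0 by rewrite mulf_neq0 ?lcst_eq0.
move=> e; apply: (mulfI cp0); rewrite mulrCA -e -[LHS]mul1r.
rewrite -{1}(divff zvar_neq0) -!mulrA; congr (_ * _).
by move: (zvar^-1) (lcst c) (u (-1)) => x y z; ring.
Qed.

End AtPoint.

(** The two expansions A and B of F/(z1/z2 - c) satisfy the same recurrence.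
    Solving it downwards for A and upwards for B produces the two halves of the
    evaluation of F at z1 = c z2. *)
Lemma raw_simple (A B F : int -> int -> K) (c : K) N : c != 0 -> bnd2 N F ->
    (forall m n, n < N -> A m n = 0) -> (forall m n, m < N -> B m n = 0) ->
    (forall m n, A (m - 1) (n + 1) - c * A m n = F m n) ->
    (forall m n, B (m - 1) (n + 1) - c * B m n = F m n) ->
  forall n, A (-1) n - B (-1) n
    = \sum_(i \in [set: int]) c ^ i * F i (n - 1 - i).
Proof.
move=> c0 FN AN BN AF BF n.
have Ak (k : nat) : A (-1) n
    = \sum_(j < k) c ^+ j * F j%:Z (n - 1 - j%:Z) + c ^+ k * A (k%:Z - 1) (n - k%:Z).
  elim: k => [|k IH]; first by rewrite big_ord0 add0r expr0 mul1r sub0r subr0.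
  rewrite IH big_ord_recr /= -addrA; congr (_ + _).
  rewrite -AF exprSr mulrBr [c ^+ k * c * _]mulrC mulrA.
  have -> : n - 1 - k%:Z + 1 = n - k%:Z by lia.
  have -> : k.+1%:Z - 1 = k by lia.
  have -> : n - k.+1%:Z = n - 1 - k%:Z by lia.
  by ring.
have Bk (k : nat) : - B (-1) n
    = \sum_(j < k) c ^ (Negz j) * F (Negz j) (n - 1 - Negz j)
      - c ^- k * B (- 1 - k%:Z) (n + k%:Z).
  elim: k => [|k IH].
    by rewrite big_ord0 add0r expr0 invr1 mul1r subr0 addr0.
  rewrite IH big_ord_recr /= -addrA; congr (_ + _).
  rewrite -BF NegzE -exprnN.
  have -> : - k.+1%:Z - 1 = - 1 - k.+1%:Z by lia.
  have -> : n - 1 - - k.+1%:Z + 1 = n + k.+1%:Z by lia.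
  have -> : n - 1 - - k.+1%:Z = n + k%:Z by lia.
  have -> : - k.+1%:Z = - 1 - k%:Z by lia.
  rewrite exprS invfM; have : c ^+ k != 0 by rewrite expf_neq0.
  move: (c ^+ k) => t t0.
  by field; rewrite c0 t0.
(* After M steps both recursions have left the supports of A and of B. *)
pose M := (absz (n - N) + absz N + 1)%N.
rewrite (Ak M) (Bk M) AN ?BN ?mulr0 ?oppr0 ?addr0; [|by rewrite /M; lia..].
rewrite (@fsumE _ _ ([seq i%:Z | i <- iota 0 M] ++ [seq Negz i | i <- iota 0 M])).
- have bm (f : nat -> K) : \sum_(j < M) f j = \sum_(j <- iota 0 M) f j.
    by rewrite -(big_mkord xpredT f) /index_iota subn0.
  by rewrite big_cat !big_map /= -!bm.
- rewrite cat_uniq !map_inj_uniq ?iota_uniq /= ?andbT => [|i j []|i j []] //.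
  by apply/hasPn => _ /mapP[i _ ->]; apply/mapP => -[].
- move=> i; rewrite mem_cat negb_or => /andP[iP iN].
  rewrite FN ?mulr0 //; case: i iP iN => i iP iN.
    have [iM|iM] := ltnP i M; last by apply/orP; right; rewrite /M in iM; lia.
    by case/mapP: iP; exists i => //; rewrite mem_iota.
  have [iM|iM] := ltnP i M; last by apply/orP; left; rewrite /M in iM; lia.
  by case/mapP: iN; exists i => //; rewrite mem_iota.
Qed.

Definition res_12 := frac_res rho12 xi12 1 res12.
Definition res_21 := frac_res rho21 xi21 1 res_outer.

Lemma zvarV : zvar^-1 = lmono 1 (-1).
Proof.
apply: (mulIf zvar_neq0); rewrite mulVf ?zvar_neq0 // /zvar lmonoM mul1r.
by rewrite addNr.
Qed.

Lemma mul_shift (a b : int) (x : L2) m n :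
  (x * (lmono 1 a * lcst (lmono 1 b))) m n = x (m - a) (n - b).
Proof.
have -> : x * (lmono 1 a * lcst (lmono 1 b)) = lmono 1 a * (lcst (lmono 1 b) * x).
  by rewrite mulrC mulrA.
by rewrite (lauc_mono 1 a) mul1r laucCM lauc_mono mul1r.
Qed.

Lemma xi12M x m n : (x * xi12) n m = x (n + 1) (m - 1).
Proof. by rewrite /xi12 (mulrC (lcst _)) mul_shift opprK. Qed.

Lemma xi21M x m n : (x * xi21) m n = x (m - 1) (n + 1).
Proof. by rewrite /xi21 zvarV mul_shift opprK. Qed.

Lemma kcstM c x m n : (x * kcst c) m n = c * x m n.
Proof. by rewrite mulrC /kcst laucCM laucCM. Qed.

Section ResidueTheorem.
Variables (p : L1) (p0 : p != 0).

Lemma residue_simple c F : c != 0 -> dlaurent F ->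
  res_12 F [:: c] - res_21 F [:: c] = res_at p c F [:: c].
Proof.
move=> c0 dF; rewrite res_at_simple //.
rewrite /res_12 /res_21 /frac_res !mul1r /qval !big_seq1.
have nz12 := rz_neq0 realization12 c.
have nz21 := rz_neq0 realization21 c.
set A := rho12 F / _; set B := rho21 F / _.
have AF : A * (xi12 - kcst c) = rho12 F by rewrite divfK.
have BF : B * (xi21 - kcst c) = rho21 F by rewrite divfK.
clearbody A B.
have dt := dlaurent_tr dF.
have [N FN] := dF; case: (lauP A) (lauP B) => NA A0 [NB B0].
pose M := Order.min N (Order.min NA NB).
apply: lau_eq => n; rewrite laucB res12E /res_outer.
rewrite (@raw_simple (fun m n => A n m) (fun m n => B m n) F c M) //.
- have [N' FN'] := dlaurent_scale1 c dF.
  rewrite lauc_mono mul1r (@dsumE _ N'); last first.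
    by move=> j m /orP[jN|mN]; rewrite ?(zcol0 FN' jN) // (zcol_lower _ FN' mN).
  rewrite (fsum_rev (n - 1)); apply: eq_zsum => j.
  by rewrite (zcolE _ _ FN') /scale1 subKr.
- by apply: bnd2_le FN; rewrite /M ge_min lexx.
- by move=> m k; rewrite /M !lt_min => /and3P[_ kA _]; rewrite A0.
- by move=> m k; rewrite /M !lt_min => /and3P[_ _ kB]; rewrite B0.
- move=> m k; rewrite -(zcolE k m FN) -rho12E // -AF mulrBr !laucB.
  by rewrite xi12M kcstM.
- move=> m k; rewrite -[RHS]/(tr F k m) -(zcolE m k (bnd2_tr FN)) -rho12E //.
  rewrite -/(rho21 F) -BF.
  by rewrite mulrBr !laucB xi21M kcstM.
Qed.

Lemma frac_res_nil_12 F : dlaurent F -> res_12 F [::] - res_21 F [::] = 0.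
Proof.
move=> dF; rewrite /res_12 /res_21 /frac_res /qval !big_nil !divr1 !mul1r.
apply: lau_eq => n; rewrite laucB res12E /res_outer /rho21 !rho12E //.
  have [N FN] := dF.
  by rewrite (zcolE _ _ FN) (zcolE _ _ (bnd2_tr FN)) subrr.
exact: dlaurent_tr.
Qed.

(** By induction on the number of roots: two distinct roots are separated by
    partial fractions, the order of a multiple root is lowered by
    [frac_res_power], and a simple root is computed directly.  Both reductions
    hold for each of the three kinds of residue. *)
Theorem residue_theorem F s (D : seq K) : dlaurent F -> uniq D ->
    0 \notin D -> {subset s <= D} ->
  res_12 F s - res_21 F s = \sum_(e <- D) res_at p e F s.
Proof.
move=> dF uD D0; have [n] := ubnP (size s).
elim: n s F dF => // n IH [|c s] F dF.
  move=> _ _; rewrite frac_res_nil_12 // big1 // => e _.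
  exact: res_at_regular.
rewrite ltnS => sn sD.
have cD : c \in D by apply: sD; rewrite mem_head.
have nz e : e \in D -> e != 0 by move=> eD; apply: contraNneq D0 => <-.
have c0 := nz c cD.
have [/all_pred1P sc|] := boolP (all (pred1 c) s).
  case: s => [|a s] in sc sn sD *.
    rewrite (bigD1_seq c) //= big1_seq ?addr0; first exact: residue_simple.
    by move=> e /andP[ec _]; apply: res_at_regular; rewrite inE.
  rewrite /= in sc; rewrite sc /= size_nseq in sn sD *.
  rewrite -/(nseq (size s).+2 c).
  have dG : dlaurent (d1 (mul2 zvar F)).
    by apply/dlaurent_d1/dlaurent_mul2.
  have := IH (nseq (size s).+1 c) _ dG.
  rewrite size_nseq => /(_ sn) IHs.
  have /IHs {}IHs : {subset nseq (size s).+1 c <= D}.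
    by move=> e he; apply: sD; rewrite inE he orbT.
  have sum_at : \sum_(e <- D) res_at p e (d1 (mul2 zvar F)) (nseq (size s).+1 c)
      = (\sum_(e <- D) res_at p e F (nseq (size s).+2 c)) *+ (size s).+1.
    rewrite -sumrMnl; apply: eq_big_seq => e /nz e0.
    by rewrite /res_at (frac_res_power (realization_at p0 e0)).
  rewrite sum_at in IHs.
  rewrite /res_12 /res_21 -(frac_res_power realization12) // in IHs.
  rewrite -(frac_res_power realization21) // -mulrnBl in IHs.
  apply/eqP; rewrite -subr_eq0; apply/eqP.
  apply: (@lau_mulz_eq0 _ _ (size s).+1) => //.
  by rewrite -pmulrn mulrnBl IHs subrr.
rewrite -has_predC => /hasP[d ds /= dc].
pose s' := rem d s.
have sE : perm_eq (c :: s) [:: c, d & s'] by rewrite perm_cons perm_to_rem.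
have dD : d \in D by apply: sD; rewrite inE ds orbT.
have szs' : size s = (size s').+1 by rewrite /s' size_rem // prednK //;
  case: (s) ds.
have cd : c != d by rewrite eq_sym.
have s'D : {subset s' <= D}.
  by move=> e /mem_rem es; apply: sD; rewrite inE es orbT.
have sub e : e \in D -> {subset e :: s' <= D}.
  by move=> eD x; rewrite inE => /orP[/eqP->|/s'D].
have IHc := IH (c :: s') F dF; have IHd := IH (d :: s') F dF.
rewrite /= -szs' in IHc IHd.
have {}IHc := IHc sn (sub c cD); have {}IHd := IHd sn (sub d dD).
have cd0 : lcst (c - d) != 0 by rewrite lcst_eq0 subr_eq0.
apply: (mulfI cd0); rewrite mulrBr [RHS]mulr_sumr.
rewrite /res_12 /res_21 !(frac_res_perm _ _ _ _ _ sE).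
rewrite (frac_res_split realization12) // (frac_res_split realization21) //.
transitivity (\sum_(e <- D) (res_at p e F (c :: s') - res_at p e F (d :: s'))).
  rewrite sumrB -IHc -IHd /res_12 /res_21 !opprB !addrA.
  by rewrite -!addrA; congr (_ + _); rewrite addrCA [RHS]addrCA; congr (_ + _);
     rewrite addrC.
apply: eq_big_seq => e /nz e0.
rewrite /res_at (frac_res_perm _ _ _ _ _ sE).
by rewrite (frac_res_split (realization_at p0 e0)).
Qed.

End ResidueTheorem.
End Residues.

(** * Linear functionals *)

Section Functionals.
Variables (K : fieldType) (W : lmodType K).

Definition functional (lam : W -> K) : Prop :=
  (forall a b, lam (a + b) = lam a + lam b) /\
  (forall c a, lam (c *: a) = c * lam a).

(** A subspace maximal among those that avoid x, given by Zorn, has the line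
    through x as a complement; lam is the coordinate on that line. *)
Lemma functional_separates (x : W) : x <> 0 ->
  exists lam, functional lam /\ lam x <> 0.
Proof.
move=> xn0.
pose P (U : set W) := [/\ forall a b, U a -> U b -> U (a + b),
  forall c a, U a -> U (c *: a) & ~ U x].
have [|A [[AD AZ Ax] Amax]] := @Zorn_bigcup _ P.
  move=> F FP Ftot; split=> [a b [U FU Ua] [T FT Tb]|c a [U FU Ua]|[U FU Ux]].
  - have [UT|TU] := Ftot _ _ FU FT.
      by exists T => //; have [TD _ _] := FP _ FT; apply: TD => //; apply: UT.
    by exists U => //; have [UD _ _] := FP _ FU; apply: UD => //; apply: TU.
  - by exists U => //; have [_ UZ _] := FP _ FU; apply: UZ.
  - by have [_ _] := FP _ FU.
have A0 : A 0.
  apply: contrapT => A0; apply: (Amax [set 0]).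
    split; first by move=> a Aa; case: A0; rewrite -(scale0r a); apply: AZ.
    by move=> /(_ 0 erefl).
  by split=> [a b -> ->|c a ->|/esym/esym]; rewrite ?addr0 ?scaler0.
have coset y : exists t, A (y - t *: x).
  have [Ay|Ay] := pselect (A y); first by exists 0; rewrite scale0r subr0.
  pose B := [set z | exists a c, A a /\ z = a + c *: y].
  have [[a [c [Aa xE]]]|Bx] := pselect (B x); last first.
    case: (Amax B).
      split=> [a Aa|BA]; first by exists a, 0; rewrite scale0r addr0.
      by apply/Ay/BA; exists 0, 1; rewrite add0r scale1r.
    split=> // [z1 z2 [a [c [Aa ->]]] [b [d [Ab ->]]]|d z [a [c [Aa ->]]]].
      exists (a + b), (c + d); split; first exact: AD.
      by rewrite scalerDl addrACA.
    exists (d *: a), (d * c); split; first exact: AZ.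
    by rewrite scalerDr scalerA.
  have c0 : c != 0.
    by apply/eqP => c0; apply: Ax; rewrite xE c0 scale0r addr0.
  exists c^-1;
    rewrite xE scalerDr scalerA mulVf // scale1r opprD addrCA subrr addr0.
  by rewrite -scaleN1r scalerA; apply: AZ.
have uniq y s t : A (y - s *: x) -> A (y - t *: x) -> s = t.
  move=> As At; apply/eqP; rewrite -subr_eq0; apply: contrapT => /negP st0.
  have Ast : A ((s - t) *: x).
    have := AD _ _ At (AZ (-1) _ As).
    by rewrite scaleN1r opprB addrC addrA subrK scalerBl.
  by apply: Ax; have := AZ (s - t)^-1 _ Ast; rewrite scalerA mulVf // scale1r.
(* The coset of y modulo A contains exactly one multiple of x. *)
pose lam y := xget 0 [set t | A (y - t *: x)].
have lamP y : A (y - lam y *: x).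
  by rewrite /lam; case: xgetP => // nt; have [t /nt] := coset y.
exists lam; split; first split=> [a b|c a].
- apply: (uniq (a + b)); first exact: lamP.
  by rewrite scalerDl opprD addrACA; apply: AD; apply: lamP.
- apply: (uniq (c *: a)); first exact: lamP.
  by rewrite -scalerA -scalerBr; apply: AZ; apply: lamP.
suff -> : lam x = 1 by apply/eqP/oner_neq0.
by apply: (uniq x) (lamP x) _; rewrite scale1r subrr.
Qed.

Lemma functional_ext (x y : W) :
  (forall lam, functional lam -> lam x = lam y) -> x = y.
Proof.
move=> xy; apply/eqP; rewrite -subr_eq0; apply/eqP; apply: contrapT => xy0.
have [lam [[lD lZ] []]] := functional_separates xy0.
by rewrite (additiveB lD) (xy lam) ?subrr.
Qed.

End Functionals.

(** * Coefficient functions as elements of the Laurent series fields *)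

Section Bridge.
Variables (K : numFieldType) (W : lmodType K).
Notation L1 := (lau K).
Notation L2 := (lau L1).
Variables (p : int -> K) (P : L1).
Hypothesis pP : forall n, P n = p n.

Lemma laurent_lmul (a : int -> K) (x : L1) (b : int -> W) :
  (forall n, x n = a n) -> laurent b -> laurent (lmul a b).
Proof.
move=> ax [N bN]; case: (lauP x) => M xM; exists (M + N) => n nMN.
apply: zsum0 => i; have [iM|iM] := ltP i M; first by rewrite -ax xM // scale0r.
by rewrite bN ?scaler0 //; lia.
Qed.

Lemma lmul_fsup (a : int -> K) (x : L1) (b : int -> W) n :
  (forall n, x n = a n) -> laurent b -> fsup (fun i => a i *: b (n - i)).
Proof.
move=> ax [N bN]; case: (lauP x) => M xM;
  apply: (@fsup_zint _ M (n - N)) => i ilt.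
  by rewrite -ax xM // scale0r.
by rewrite bN ?scaler0 //; lia.
Qed.

Lemma laurent_fderiv (b : int -> W) : laurent b -> laurent (fderiv b).
Proof.
by move=> [N bN]; exists (N - 1) => n nN; rewrite /fderiv bN ?mul0rz //; lia.
Qed.

Lemma laurent_pderiv (b : int -> W) : laurent b -> laurent (pderiv p b).
Proof. by move=> lb; apply: laurent_lmul pP _; apply: laurent_fderiv. Qed.

Variable lam : W -> K.
Hypothesis lamF : functional lam.

Let lamD := lamF.1.
Let lamZ := lamF.2.
Let lam0 : lam 0 = 0 := additive0 lamD.

Definition lser (b : int -> W) : L1 := mkl (fun n => lam (b n)).
Definition lser2 (B : int -> int -> W) : L2 := mkl (fun k => lser (B k)).

Lemma lserE b n : laurent b -> lser b n = lam (b n).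
Proof. by case=> N bN; apply: mklE; exists N => m /bN ->. Qed.

Lemma lser_lmul (a : int -> K) (x : L1) (b : int -> W) n :
  (forall n, x n = a n) -> laurent b -> lam (lmul a b n) = (x * lser b) n.
Proof.
move=> ax lb; rewrite (fsum_morph lamD) ?laucM; last exact: lmul_fsup ax lb.
by apply: eq_zsum => i; rewrite lamZ ax lserE.
Qed.

Lemma lser_pderiv b n : laurent b -> lam (pderiv p b n) = vder P (lser b) n.
Proof.
move=> lb; have lf := laurent_fderiv lb; rewrite (lser_lmul _ pP) //.
have -> // : lser (fderiv b) = ldiff (lser b).
apply: lau_eq => m; rewrite ldiffE !lserE //.
by rewrite /fderiv (additiveMz lamD).
Qed.

Lemma lser_exp b k n : laurent b -> lam (exp_pderiv p b k n) = flow P (lser b) k n.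
Proof.
move=> lb; case: k => k; last by rewrite /exp_pderiv lam0 flow_neg.
rewrite /exp_pderiv lamZ flow_pos laucCM; congr (_ * _).
have lk m : laurent (iter m (pderiv p) b).
  by elim: m => //= m IH; apply: laurent_pderiv.
elim: k n => [|k IH] n; first by rewrite lserE.
rewrite !iterS lser_pderiv //; congr (vder P _ n); apply: lau_eq => m.
by rewrite lserE // IH.
Qed.

Lemma lser2E (B : int -> int -> W) k : 
  (exists N : int, forall k, k < N -> B k = fun=> 0) -> lser2 B k = lser (B k).
Proof.
case=> N BN; apply: (mklE (f := fun k => lser (B k))); exists N => m /BN ->.
by apply: lau_eq => n; rewrite lserE ?lam0 //; exists 0.
Qed.

Lemma lser2_lmul2 (A : int -> int -> K) (x : L2) (B : int -> int -> W) k n :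
    (forall i n, x i n = A i n) ->
    (exists N : int, forall k, k < N -> B k = fun=> 0) ->
    (forall k, laurent (B k)) ->
  lam (lmul2 A B k n) = (x * lser2 B) k n.
Proof.
move=> xA BN lB; have [N B0] := BN; case: (lauP x) => M xM.
rewrite /lmul2 (fsum_morph lamD); last first.
  apply: (@fsup_zint _ M (k - N)) => i ilt; apply: zsum0 => j.
    by rewrite -xA xM // scale0r.
  by rewrite B0 ?scaler0 //; lia.
rewrite laucM (fsum_morph (h := fun t : L1 => t n)) //; last exact: conv_fsup.
by apply: eq_zsum => i; rewrite (lser_lmul _ (xA i)) ?lser2E.
Qed.

End Bridge.

Section BridgeSubst.
Variables (K : numFieldType) (W : lmodType K).
Notation L1 := (lau K).
Notation L2 := (lau L1).
Variables (p : int -> K) (P : L1).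
Hypothesis pP : forall n, P n = p n.

Lemma bnd2_lam (lam : W -> K) N (A : int -> int -> W) : functional lam ->
  (forall m n : int, (m < N) || (n < N) -> A m n = 0) ->
  bnd2 N (fun m n => lam (A m n)).
Proof. by move=> [lamD _] AN m n mn; rewrite AN // (additive0 lamD). Qed.

Lemma laurent2_col (A : int -> int -> W) n : laurent2 A -> laurent (fun m => A m n).
Proof. by case=> N AN; exists N => m mN; rewrite AN ?mN. Qed.

(** The finiteness of the diagonal sum in W is itself tested by functionals,
    because the bounds on its support do not depend on the functional. *)
Lemma lser_subst_phi (lam : W -> K) (A : int -> int -> W) k n :
    functional lam -> laurent2 A ->
  lam (subst_phi p A k n) = phisub P (fun m n => lam (A m n)) k n.
Proof.
move=> lamF lA; have [N AN] := lA; have AN' mu muF := @bnd2_lam mu N A muF AN.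
have dlA : dlaurent (fun m n => lam (A m n)) by exists N; apply: AN'.
have colA mu (muF : functional mu) j : lser mu (fun m => A m j)
    = zcol (fun m n => mu (A m n)) j by [].
have [v pv] := lauP P.
have expE mu (muF : functional mu) j i :
    mu (exp_pderiv p (fun m => A m j) k i)
    = flow P (zcol (fun m n => mu (A m n)) j) k i.
  by rewrite (lser_exp pP muF) //; apply: laurent2_col.
rewrite phisub_coef // (fsum_rev n).
rewrite /subst_phi /diagonal (fsum_morph (proj1 lamF)).
  by apply: eq_zsum => i; rewrite subKr expE.
apply: (@fsup_zint _ (N + k * (v - 1)) (n - N)) => i ilt;
  apply: functional_ext => mu muF; rewrite expE // (additive0 (proj1 muF)).
  by apply: (flow_lower pv) ilt => m; apply: zcol_lower (AN' mu muF).
by rewrite (zcol0 (AN' mu muF)) ?flow_at0 //; lia.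
Qed.

Lemma phiE k n : phi p k n = phi0 P k n.
Proof.
have idF : functional (fun x : K^o => x) by split.
have lb : laurent (fun n : int => (n == 1)%:R : K^o).
  by exists 1 => m m1; rewrite lt_eqF.
rewrite /phi (lser_exp pP idF k n lb) /phi0; congr (flow P _ k n).
by apply: lau_eq => m; rewrite (lserE idF) // laucE; case: eqP.
Qed.

Lemma series2_expE (A : int -> int -> K) (x : L2) i :
    (forall k n, x k n = A k n) ->
  forall k n, series2_exp A i k n = (x ^+ i) k n.
Proof.
move=> xA.
have idF : functional (fun x : K^o => x) by split.
elim: i => [|i IH] k n.
  rewrite expr0 lauc1; case: (k =P 0) => [->|/eqP/negPf kn].
    by rewrite lauc1 /series2_exp /= ; case: eqP.
  by rewrite /series2_exp /= kn.
have sE : series2_exp A i = fun k n => (x ^+ i) k n.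
  by apply: funext => l; apply: funext => m; apply: IH.
rewrite /series2_exp iterS -/(series2_exp A i) sE exprS.
rewrite (lser2_lmul2 idF k n xA).
- congr ((x * _) k n); apply: lau_eq => l; rewrite (lser2E idF).
    by apply: lau_eq => m; rewrite (lserE idF) //; apply: lauP.
  case: (lauP (x ^+ i)) => N xN; exists N => m mN; apply: funext => j.
  by rewrite xN.
- case: (lauP (x ^+ i)) => N xN; exists N => m mN; apply: funext => j.
  by rewrite xN.
- by move=> l; apply: lauP.
Qed.

(** f(x, z2). *)
Definition polyval (f : {poly {poly K}}) (x : L2) : L2 :=
  \sum_(i < size f) \sum_(j < size f`_i)
    kcst f`_i`_j * (x ^+ i * lcst (lmono 1 j%:Z)).

Lemma poly2_substE f k n : poly2_subst f (phi p) k n = polyval f (phi0 P) k n.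
Proof.
rewrite /poly2_subst /polyval !lauc_sum; apply: eq_bigr => i _.
rewrite !lauc_sum; apply: eq_bigr => j _.
rewrite /kcst laucCM laucCM; congr (_ * _).
rewrite (series2_expE i (x := phi0 P)); last by move=> *; rewrite phiE.
by rewrite [_ ^+ i * _]mulrC laucCM lauc_mono mul1r.
Qed.

Lemma phisub_sum (I : Type) (r : seq I) (G : I -> int -> int -> K) :
    (forall i, dlaurent (G i)) ->
  dlaurent (fun m n => \sum_(i <- r) G i m n) /\
  phisub P (fun m n => \sum_(i <- r) G i m n) = \sum_(i <- r) phisub P (G i).
Proof.
move=> dG; elim: r => [|i r [IH1 IH2]].
  rewrite big_nil (_ : (fun _ _ => _) = fun _ _ => 0); last first.
    by apply: ext2 => m n; rewrite big_nil.
  have d0 : dlaurent (fun _ _ => 0 : K) by exists 0.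
  split=> //; apply: (@addIr _ (phisub P (fun _ _ => 0))).
  by rewrite add0r -phisubD //; congr phisub; apply: ext2 => m n; rewrite addr0.
rewrite big_cons -IH2 -phisubD // (_ : (fun _ _ => _) = fun m n =>
  G i m n + \sum_(j <- r) G j m n); last by apply: ext2 => m n; rewrite big_cons.
by split=> //; apply: dlaurentD.
Qed.

Definition zshift (a b : int) (F : int -> int -> K) : int -> int -> K :=
  fun m n => F (m - a) (n - b).

Lemma phisub_zshift a b F : dlaurent F ->
  dlaurent (zshift a b F) /\
  phisub P (zshift a b F) = flow P (lmono 1 a) * lcst (lmono 1 b) * phisub P F.
Proof.
move=> dF; have [N FN] := dF.
have d2 := dlaurent_mul2 (lmono 1 b) dF; have [M FM] := d2.
have -> : zshift a b F = mul1 (lmono 1 a) (mul2 (lmono 1 b) F).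
  apply: ext2 => m n; rewrite /mul1 lauc_mono mul1r (zcolE _ _ FM).
  by rewrite /mul2 /tr /mul1 lauc_mono mul1r (zcolE _ _ (bnd2_tr FN)).
split; first exact: dlaurent_mul1.
by rewrite phisub_mul1 // phisub_mul2 // mulrA.
Qed.

Lemma phisub_poly2_mul f F : dlaurent F ->
  dlaurent (poly2_mul (W := K^o) f F) /\
  phisub P (poly2_mul (W := K^o) f F) = polyval f (phi0 P) * phisub P F.
Proof.
move=> dF.
have term (i j : nat) : dlaurent (fun m n => f`_i`_j * zshift i j F m n) /\
    phisub P (fun m n => f`_i`_j * zshift i j F m n)
    = kcst f`_i`_j * (phi0 P ^+ i * lcst (lmono 1 j%:Z)) * phisub P F.
  have [dz tz] := phisub_zshift i j dF; split; first exact: dlaurentZ.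
  rewrite phisubZ // tz mulrA; congr (_ * (_ * _) * _).
  elim: i {dz tz} => [|i IH]; first by rewrite expr0 -/(1 : L1) flow_at1.
  by rewrite exprS -IH /phi0 -flowM /zvar lmonoM mulr1 -PoszD add1n.
have inner (i : nat) :=
  @phisub_sum _ (index_enum 'I_(size f`_i)) (fun j m n => f`_i`_j * zshift i j F m n)
    (fun j => (term i j).1).
have [dout tout] := @phisub_sum _ (index_enum 'I_(size f)) _ (fun i => (inner i).1).
split=> //; rewrite [LHS]tout /polyval mulr_suml; apply: eq_bigr => i _.
rewrite (inner i).2 mulr_suml; apply: eq_bigr => j _.
exact: (term i j).2.
Qed.

(** Multiplication by e (z1/z2)^a - s.  The case a = -1 comes from exchanging z1
    and z2, and e different from 1 from rescaling z1. *)
Definition rop (a : int) (e s : K) (F : int -> int -> K) : int -> int -> K :=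
  fun m n => e * F (m - a) (n + a) - s * F m n.
Definition opl a e rs F := foldr (rop a e) F rs.

(** The image of e (z1/z2)^a - s under z1 = phi(z2, z0). *)
Definition ropval (a : int) (e s : K) : L2 :=
  kcst e * (flow P (lmono 1 a) * lcst (lmono 1 (- a))) - kcst s.

Lemma phisub_rop a e s F : dlaurent F ->
  dlaurent (rop a e s F) /\ phisub P (rop a e s F) = ropval a e s * phisub P F.
Proof.
move=> dF; have [dz tz] := phisub_zshift a (- a) dF.
have -> : rop a e s F = fun m n => e * zshift a (- a) F m n + (- s) * F m n.
  by apply: ext2 => m n; rewrite /rop /zshift opprK mulNr.
split; first by apply: dlaurentD; apply: dlaurentZ.
rewrite phisubD ?phisubZ ?tz //; [|exact: dlaurentZ..].
by rewrite /ropval mulrBl /kcst !lcstN mulNr mulrA.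
Qed.

Lemma phisub_opl a e rs F : dlaurent F ->
  dlaurent (opl a e rs F) /\
  phisub P (opl a e rs F) = (\prod_(s <- rs) ropval a e s) * phisub P F.
Proof.
move=> dF; elim: rs => [|s rs [IH1 IH2]]; first by rewrite big_nil mul1r.
have [d t] := phisub_rop a e s IH1.
by split=> //; rewrite /= t IH2 big_cons mulrA.
Qed.

Lemma poly2_mul_opl f a e rs F :
  poly2_mul (W := K^o) f (opl a e rs F) = opl a e rs (poly2_mul (W := K^o) f F).
Proof.
elim: rs => //= s rs <-; move: (opl a e rs F) => G; apply: ext2 => m n.
rewrite /rop /poly2_mul !mulr_sumr -sumrB; apply: eq_bigr => i _.
rewrite !mulr_sumr -sumrB; apply: eq_bigr => j _.
have zE (c x : K) : c *: (x : K^o) = c * x by [].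
rewrite !zE mulrBr; congr (_ - _); rewrite mulrCA //.
by congr (_ * (_ * G _ _)); lia.
Qed.

Section Cancellation.
Variable v : int.
Hypotheses (Pv : pval P v) (Pv0 : P v != 0).

Definition delta0 (m n : int) : K := ((m == 0) && (n == 0))%:R.

Lemma dlaurent_delta0 : dlaurent delta0.
Proof.
by exists 0 => m n /orP[|] lt0; rewrite /delta0 (lt_eqF lt0) ?andbF.
Qed.

(** phi is transcendental over K(z2): f(phi, z2) is the image of f(z1, z2) under
    the injective substitution. *)
Lemma polyval_neq0 (f : {poly {poly K}}) : f != 0 -> polyval f (phi0 P) != 0.
Proof.
move=> f0; apply/eqP => pf0.
have [df tf] := phisub_poly2_mul f dlaurent_delta0.
rewrite pf0 mul0r in tf; have fz := phisub_inj0 Pv Pv0 df tf.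
pose i := (size f).-1; pose j := (size f`_i).-1.
have szf : (0 < size f)%N by rewrite size_poly_gt0.
have fi0 : f`_i != 0 by rewrite -lead_coefE lead_coef_eq0.
have szi : (0 < size (f`_i)%R)%N by rewrite size_poly_gt0.
have li : (i < size f)%N by rewrite prednK.
have lj : (j < size (f`_i)%R)%N by rewrite prednK.
have := fz i j;
  rewrite /poly2_mul (bigD1 (Ordinal li)) //= (bigD1 (Ordinal lj)) //=.
rewrite /delta0 !subrr eqxx big1 ?addr0 => [|k kj]; last first.
  rewrite (_ : (j%:Z - k%:Z == 0) = false) ?andbF ?scaler0 //.
  by apply: contraNF kj; rewrite subr_eq0 => /eqP[jk]; apply/eqP/val_inj.
rewrite big1 ?addr0 => [|k ki]; last first.
  apply: big1 => l _; rewrite (_ : (i%:Z - k%:Z == 0) = false) ?scaler0 //.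
  by apply: contraNF ki; rewrite subr_eq0 => /eqP[ik]; apply/eqP/val_inj.
move/eqP; rewrite /= [X in X == 0]mulr1 -lead_coefE lead_coef_eq0.
exact/negP.
Qed.

(** Associativity holds for A multiplied by some nonzero polynomial f.  It holds
    equally for any other product of A that lies in K((z1, z2)), as
    f(phi, z2) can be cancelled. *)
Lemma phisub_opl_assoc (f : {poly {poly K}}) a e rs (A : int -> int -> K) (x : L2) :
    f != 0 ->
    dlaurent (poly2_mul (W := K^o) f A) ->
    polyval f (phi0 P) * x = phisub P (poly2_mul (W := K^o) f A) ->
    dlaurent (opl a e rs A) ->
  phisub P (opl a e rs A) = (\prod_(s <- rs) ropval a e s) * x.
Proof.
move=> f0 dfA fx dA; apply: (mulfI (polyval_neq0 f0)).
rewrite -(phisub_poly2_mul f dA).2 poly2_mul_opl (phisub_opl a e rs dfA).2.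
by rewrite -fx mulrCA.
Qed.

End Cancellation.
End BridgeSubst.

Section Operators.
Variable K : numFieldType.
Notation L1 := (lau K).
Notation L2 := (lau L1).
Implicit Types (F G A B : int -> int -> K) (rs bs : seq K).

Lemma dlaurent_zshift a b F : dlaurent F -> dlaurent (zshift a b F).
Proof.
case=> N FN; exists (Order.min (N + a) (N + b)) => m n.
by rewrite !lt_min /zshift => mn; apply: FN; lia.
Qed.

Lemma rop_comm a e s b f t F : rop a e s (rop b f t F) = rop b f t (rop a e s F).
Proof.
apply: ext2 => m n; rewrite /rop (_ : m - a - b = m - b - a); last by lia.
rewrite (_ : n + a + b = n + b + a); last by lia.
by ring.
Qed.

Lemma opl_comm1 a e s b f rs F :
  rop a e s (opl b f rs F) = opl b f rs (rop a e s F).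
Proof. by elim: rs => //= t rs <-; apply: rop_comm. Qed.

Lemma opl_comm a e rs b f ts F :
  opl a e rs (opl b f ts F) = opl b f ts (opl a e rs F).
Proof. by elim: rs => //= s rs ->; apply: opl_comm1. Qed.

Lemma opl_cat a e rs ts F : opl a e (rs ++ ts) F = opl a e rs (opl a e ts F).
Proof. by rewrite /opl foldr_cat. Qed.

Lemma tr_opl a e rs F : tr (opl a e rs F) = opl (- a) e rs (tr F).
Proof.
elim: rs => //= s rs <-; apply: ext2 => m n.
by rewrite /tr /rop opprK.
Qed.

Lemma zshift_opl a e b rs F : zshift b 0 (opl a e rs F) = opl a e rs (zshift b 0 F).
Proof.
elim: rs => //= s rs <-; apply: ext2 => m n; rewrite /zshift /rop !subr0.
by rewrite (_ : m - b - a = m - a - b) //; lia.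
Qed.

Lemma scale1_opl e rs F : e != 0 ->
  scale1 e (opl 1 1 rs F) = opl 1 e rs (scale1 e F).
Proof.
move=> e0; elim: rs => //= s rs <-; apply: ext2 => m n; rewrite /scale1 /rop.
rewrite mul1r mulrBr mulrCA; congr (_ - _).
rewrite mulrA -[X in X * _ * _]expr1z -expfzDr //.
by congr (_ ^ _ * _); lia.
Qed.

(** z2/z1 - b and z1/z2 - 1/b differ by the unit - b z2/z1. *)
Lemma dlaurent_opl_inv bs F : (forall b, b \in bs -> b != 0) ->
  dlaurent (opl (-1) 1 bs F) -> dlaurent (opl 1 1 [seq b^-1 | b <- bs] F).
Proof.
elim: bs F => //= b bs IH F bs0; rewrite opl_comm1 => /IH dF.
have b0 : b != 0 by apply: bs0; rewrite mem_head.
have {dF} : dlaurent (opl 1 1 [seq b^-1 | b <- bs] (rop (-1) 1 b F)).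
  by apply: dF => c cbs; apply: bs0; rewrite inE cbs orbT.
rewrite -opl_comm1; move: (opl _ _ _ F) => G dG.
have -> : rop 1 1 b^-1 G
    = fun m n => - b^-1 * zshift 1 (-1) (rop (-1) 1 b G) m n.
  apply: ext2 => m n; rewrite /zshift /rop !opprK subrK addrK !mul1r.
  by field.
by apply: dlaurentZ; apply: dlaurent_zshift.
Qed.

Lemma opl1_xi (P : L1) e rs :
  \prod_(s <- rs) ropval P 1 e s = qval (xi_at P e) rs.
Proof. by apply: eq_bigr => s _; rewrite /ropval /xi_at zvarV. Qed.

Lemma flip_opl (P : L1) rs (x : L2) :
  flip P ((\prod_(s <- rs) ropval P (-1) 1 s) * x)
  = (\prod_(s <- rs) ropval P 1 1 s) * flip P x.
Proof.
elim: rs => [|s rs IH]; first by rewrite !big_nil !mul1r.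
rewrite !big_cons -!mulrA -IH; move: (_ * x) => y.
rewrite /ropval !mulrBl (additiveB (flipD P)) !mul1r !opprK.
congr (_ - _); last by rewrite flip_cst flowC.
by rewrite -mulrA flip_flow flip_cst mulrA [lcst _ * _]mulrC.
Qed.

(** A lies in K((z1))((z2)). *)
Definition iter12 A : Prop :=
  (exists N : int, forall m n, n < N -> A m n = 0) /\
  (forall n, bounded_below (fun m => A m n)).

Lemma iter12_rop a s A : iter12 A -> iter12 (rop a 1 s A).
Proof.
move=> [[N AN] Ab]; split.
  exists (Order.min N (N - a)) => m n; rewrite lt_min => /andP[lt1 lt2].
  by rewrite /rop !AN ?mulr0 ?subr0 //; lia.
move=> n; have [M1 A1] := Ab n; have [M2 A2] := Ab (n + a).
exists (Order.min M1 (M2 + a)) => m; rewrite lt_min => /andP[lt1 lt2].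
by rewrite /rop A1 // A2 ?mulr0 ?subr0 //; lia.
Qed.

Lemma iter12_opl a rs A : iter12 A -> iter12 (opl a 1 rs A).
Proof. by move=> tA; elim: rs => //= s rs; apply: iter12_rop. Qed.

Lemma rho12_coef A m n : iter12 A -> rho12 A n m = A m n.
Proof.
move=> [[N AN] Ab].
have zE k j : zcol A j k = A k j by apply: (mklE (Ab j)).
rewrite /rho12 (mklE (f := fun n => zcol A n)) //.
by exists N => j jN; apply: lau_eq => k; rewrite zE AN.
Qed.

Lemma rho12_opl rs A : iter12 A -> rho12 (opl 1 1 rs A) = rho12 A * qval (xi12 K) rs.
Proof.
move=> tA; elim: rs => [|s rs IH]; first by rewrite /qval big_nil mulr1.
rewrite /qval big_cons [_ * qval _ _]mulrC mulrA -/(qval _ rs) -IH /=.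
have tr := iter12_opl 1 rs tA; apply: lau_eq => n; apply: lau_eq => m.
rewrite mulrBr !laucB xi12M kcstM !rho12_coef //; last exact: iter12_rop.
by rewrite /rop mul1r.
Qed.

Lemma rho21_coef B m n : iter12 (tr B) -> rho21 B m n = B m n.
Proof. exact: rho12_coef. Qed.

Lemma rho21_opl rs B : iter12 (tr B) ->
  rho21 (opl 1 1 rs B) = rho21 B * qval (xi21 K) rs.
Proof.
move=> tB; elim: rs => [|s rs IH]; first by rewrite /qval big_nil mulr1.
rewrite /qval big_cons [_ * qval _ _]mulrC mulrA -/(qval _ rs) -IH /=.
have tG : iter12 (tr (opl 1 1 rs B)) by rewrite tr_opl; apply: iter12_opl.
have tS : iter12 (tr (opl 1 1 (s :: rs) B)) by rewrite tr_opl; apply: iter12_opl.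
apply: lau_eq => m; apply: lau_eq => n.
rewrite mulrBr !laucB xi21M kcstM !rho21_coef //.
by rewrite /rop mul1r.
Qed.

Lemma iter12_zshift b A : iter12 A -> iter12 (zshift b 0 A).
Proof.
move=> [[N AN] Ab]; split; first by exists N => m n nN; rewrite /zshift AN ?subr0.
move=> n; have [M AM] := Ab n; exists (M + b) => m mM.
by rewrite /zshift subr0 AM //; lia.
Qed.

Lemma iter12_tr_zshift b B : iter12 (tr B) -> iter12 (tr (zshift b 0 B)).
Proof.
move=> [[N BN] Bb]; split.
  by exists (N + b) => m n nN; rewrite /tr /zshift subr0; apply: BN; lia.
move=> n; have [M BM] := Bb (n - b); exists M => m mM.
by rewrite /tr /zshift subr0; apply: BM.
Qed.

(** Coefficient m in z1 is the residue after multiplication by z1^(-m-1). *)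
Lemma commutator_residues (P : L1) A B F rs (D : seq K) :
    P != 0 -> dlaurent F -> iter12 A -> iter12 (tr B) ->
    opl 1 1 rs A = F -> opl 1 1 rs B = F ->
    uniq D -> 0 \notin D -> {subset rs <= D} ->
  forall m n, A m n - B m n
    = (\sum_(e <- D) res_at P e (zshift (- m - 1) 0 F) rs) n.
Proof.
move=> P0 dF tA tB AF BF uD D0 rsD m n; set b := - m - 1.
have dG : dlaurent (zshift b 0 F) by apply: dlaurent_zshift.
rewrite -(residue_theorem P0 dG uD D0 rsD) laucB.
have tAb := iter12_zshift b tA; have tBb := iter12_tr_zshift b tB.
rewrite /res_12 /frac_res -{1}AF zshift_opl rho12_opl // mul1r.
rewrite mulfK ?(qval_neq0 (realization12 K)) // res12E rho12_coef //.
rewrite /res_21 /frac_res -BF zshift_opl rho21_opl // mul1r.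
rewrite mulfK ?(qval_neq0 (realization21 K)) // /res_outer rho21_coef //.
by rewrite /zshift subr0 (_ : - 1 - b = m) // /b; lia.
Qed.

(** The local residue at e in terms of the expansion x of F/Q there: the factor
    z1^(-m-1) dz1 becomes exp(z0 D) of e^(-m) z^(-m-1) p(z). *)
Lemma res_at_term (P : L1) e F rs (x : L2) m : P != 0 -> e != 0 -> dlaurent F ->
    phisub P (scale1 e F) = qval (xi_at P e) rs * x ->
  res_at P e (zshift (- m - 1) 0 F) rs
  = (flow P (lcst (e ^ (- m)) * (lmono 1 (- m - 1) * P)) * x) (-1).
Proof.
move=> P0 e0 dF Fx; rewrite /res_at /frac_res /res_outer /rho_at;
  congr (coefl _ (-1)).
have dS := dlaurent_scale1 e dF.
have -> : scale1 e (zshift (- m - 1) 0 F)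
    = fun i j => e ^ (- m - 1) * zshift (- m - 1) 0 (scale1 e F) i j.
  apply: ext2 => i j; rewrite /scale1 /zshift mulrA -expfzDr //.
  by congr (_ ^ _ * _); lia.
have [dZ tZ] := phisub_zshift P (- m - 1) 0 dS.
rewrite phisubZ // tZ Fx [lcst (lmono 1 0)](_ : _ = 1) // mulr1.
rewrite /omega_at [qval _ _ * x]mulrC !mulrA.
rewrite mulfK ?(qval_neq0 (realization_at P0 e0)) //.
congr (_ * _); rewrite !flowM flowC -[lcst (lcst (e ^ (- m)))]/(kcst _).
have -> : kcst (e ^ (- m)) = kcst e * kcst (e ^ (- m - 1)).
  rewrite /kcst -!lcstM -[X in lcst (lcst (X * _))]expr1z -expfzDr //.
  by congr (lcst (lcst (_ ^ _))); lia.
by rewrite -!mulrA; congr (_ * _); rewrite mulrCA; congr (_ * _); rewrite mulrC.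
Qed.

End Operators.

Lemma lcst_signz (K : numFieldType) (j : int) : lcst ((-1) ^ j) = (-1) ^ j :> lau K.
Proof.
have lX (n : nat) : lcst ((-1) ^+ n) = (-1) ^+ n :> lau K.
  by elim: n => // n IH; rewrite !exprS lcstM IH lcstN.
by case: j => n; rewrite ?NegzE -?exprnN ?lcstV lX.
Qed.

(** * Modules *)

Section LinearMaps.
Variables (K : fieldType) (V W : lmodType K) (h : V -> W) (hL : linear h).

Lemma linear_zero : h 0 = 0.
Proof. by have := hL (-1) 0 0; rewrite scaleN1r oppr0 addr0 scaleN1r addNr. Qed.
Lemma linear_add a b : h (a + b) = h a + h b.
Proof. by have := hL 1 a b; rewrite !scale1r. Qed.
Lemma linear_scale c a : h (c *: a) = c *: h a.
Proof. by have := hL c a 0; rewrite !addr0 linear_zero addr0. Qed.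

End LinearMaps.

Section QuasiModules.
Variables (K : numFieldType) (p : int -> K) (P : lau K).
Hypotheses (pP : forall n, P n = p n) (P0 : P != 0).
Variables (V W : lmodType K) (Y : V -> V -> int -> V) (vac : V).
Variable YW : V -> W -> int -> W.
Hypotheses (va : vertex_algebra Y vac) (wm : phi_quasi_module p Y vac YW).
Notation L1 := (lau K).
Notation L2 := (lau L1).

Let YWl w n : linear (fun v : V => YW v w n).
Proof. by case: (pqm_field wm). Qed.
Let YWr v n : linear (fun w : W => YW v w n).
Proof. by case: (pqm_field wm). Qed.
Let YWb v w : laurent (YW v w).
Proof. by case: (pqm_field wm). Qed.
Let Yb u v : laurent (Y u v).
Proof. by case: (va_field va). Qed.

Lemma iterY_below u v w :
  exists N : int, forall k, k < N -> iterY Y YW u v w k = fun=> 0.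
Proof.
have [N YN] := Yb u v; exists N => k kN; apply: funext => n.
by rewrite /iterY YN // (linear_zero (YWl w n)).
Qed.

Variables (lam : W -> K) (lamF : functional lam).
Let lamD := lamF.1.
Let lamZ := lamF.2.
Let lam0 : lam 0 = 0 := additive0 lamD.

Definition iterL u v w : L2 := lser2 lam (iterY Y YW u v w).

Lemma iterLE u v w k n : iterL u v w k n = lam (YW (Y u v k) w n).
Proof.
rewrite /iterL (lser2E lamF); last exact: iterY_below.
by rewrite (lserE lamF) //; apply: YWb.
Qed.

Definition prodL u v w : int -> int -> K := fun m n => lam (prodY YW u v w m n).

Lemma lam_poly2_mul f (A : int -> int -> W) m n :
  lam (poly2_mul f A m n) = poly2_mul (W := K^o) f (fun i j => lam (A i j)) m n.
Proof.
rewrite /poly2_mul (big_morph lam lamD lam0); apply: eq_bigr => i _.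
by rewrite (big_morph lam lamD lam0); apply: eq_bigr => j _; rewrite lamZ.
Qed.

Lemma assocL u v : exists2 f : {poly {poly K}}, f != 0 & forall w,
  dlaurent (poly2_mul (W := K^o) f (prodL u v w)) /\
  polyval f (phi0 P) * iterL u v w = phisub P (poly2_mul (W := K^o) f (prodL u v w)).
Proof.
have [f f0 [fl fa]] := pqm_assoc wm u v; exists f => // w.
have fE : (fun m n => lam (poly2_mul f (prodY YW u v w) m n))
    = poly2_mul (W := K^o) f (prodL u v w).
  by apply: ext2 => m n; rewrite lam_poly2_mul.
rewrite -fE; split.
  by have [N fN] := fl w; exists N; apply: bnd2_lam.
apply: lau_eq => k; apply: lau_eq => n.
rewrite -(lser_subst_phi pP k n lamF (fl w)) -fa.
rewrite (lser2_lmul2 lamF k n (x := polyval f (phi0 P))) //.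
- by move=> i j; rewrite (poly2_substE pP).
- exact: iterY_below.
- by move=> l; apply: YWb.
Qed.

Let Pv : exists v, pval P v /\ P v != 0.
Proof. by have [v [v1 v2]] := lau_valP P0; exists v. Qed.

(** Associativity with the vacuum as second argument: Y_W(u, z1) 1 does not
    involve z2, so it can be substituted as it stands and f(phi, z2) cancels. *)
Lemma iterL_vac u w : iterL u vac w = flow P (lser lam (YW u w)).
Proof.
have [v [pv Pv0]] := Pv; have [f f0 /(_ w)[df fx]] := assocL u vac.
set b := lser lam (YW u w).
have prodE : prodL u vac w = fun m n => if n == 0 then b m else 0.
  apply: ext2 => m n; rewrite /prodL /prodY (pqm_vacuum wm).
  case: eqP => _; first by rewrite (lserE lamF).
  by rewrite (linear_zero (YWr u m)).
have [N bN] := lauP b.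
have bA : bnd2 (Order.min N 0) (prodL u vac w).
  move=> m n; rewrite prodE !lt_min => /orP[/andP[lt1 _]|/andP[_ lt1]].
    by rewrite bN //; case: ifP.
  by rewrite lt_eqF.
have dA : dlaurent (prodL u vac w) by exists (Order.min N 0).
have tA : phisub P (prodL u vac w) = flow P b.
  apply: lau_eq => k; apply: lau_eq => n; rewrite phisub_coef //.
  have zE : zcol (prodL u vac w) 0 = b.
    by apply: lau_eq => m; rewrite (zcolE _ _ bA) prodE eqxx.
  rewrite (@zsum1 _ 0) ?subr0 ?zE // => j j0.
  rewrite (_ : zcol _ j = 0) ?flow_at0 //.
  by apply: lau_eq => m; rewrite (zcolE _ _ bA) prodE (negPf j0).
apply: (mulfI (polyval_neq0 pv Pv0 f0)); rewrite fx -tA.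
by rewrite (phisub_poly2_mul P f dA).2.
Qed.

(** The Jacobi identity applied to the vacuum, in the components m = -1, n = 0:
    the first sum vanishes, the second has a single term, and the binomials
    on the right are signs. *)
Lemma skew_symmetry u v k :
  (-1) ^ k *: Y v u k
  = \sum_(i \in [set: nat]) (-1) ^+ i *: Y (Y u v (k - i%:Z)) vac i.
Proof.
have [YL1 YL2 _] := va_field va.
have Y0 a n : Y a 0 n = 0 by exact: (linear_zero (YL2 a n)).
have cre a (n : int) : n < 0 -> Y a vac n = 0 by have [h _] := va_creation va a; apply: h.
have := va_jacobi va u v vac (- k - 1) (-1) 0.
rewrite [X in X - _]fsum0 ?sub0r => [|i]; last first.
  by rewrite /mode (cre v) ?Y0 ?scaler0 //; lia.
rewrite (@fsum1 _ _ 0%N) => [|i i0]; last first.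
  by rewrite /mode (cre u) ?Y0 ?scaler0 //; lia.
rewrite /mode expr0 mulr1 /binomz big_ord0 fact0 divr1 mulr1.
have -> : - (-1 + 0%:Z) - 1 = 0 by lia.
have [_ ->] := va_creation va u.
have -> : - (0 + (- k - 1) - 0%:Z) - 1 = k by lia.
have sgn : - ((-1) ^ (- k - 1)) = (-1) ^ k :> K.
  have m1 : (-1 : K) != 0 by rewrite oppr_eq0 oner_eq0.
  by rewrite expfzDr // -!exprz_inv !invrN1 expr1z mulrN1 opprK.
rewrite -scaleNr sgn => ->; apply: eq_fsum => i.
have -> : - (- k - 1 + i%:Z) - 1 = k - i%:Z by lia.
have -> : - (-1 + 0 - i%:Z) - 1 = i%:Z by lia.
congr (_ *: _); rewrite (eq_bigr (fun j : 'I_i => - (j.+1)%:R)); last first.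
  move=> j _; rewrite (_ : -1 - j%:Z = - (j.+1)%:Z); last by lia.
  by rewrite mulrNz -pmulrn.
rewrite prodrN /= card_ord; have -> : \prod_(j < i) j.+1%:R = i`!%:R :> K.
  by rewrite -natr_prod fact_prod big_add1 big_mkord.
by rewrite mulfK // pnatr_eq0 -lt0n fact_gt0.
Qed.

(** Skew symmetry of Y transported by Y_W, where [iterL_vac] turns the
    exponential of the translation operator into that of D. *)
Lemma flip_iterL u v w : iterL v u w = flip P (iterL u v w).
Proof.
apply: lau_eq => k; apply: lau_eq => n; rewrite iterLE flipE.
have [N YN] := Yb u v.
have X0 j : j < N -> iterL u v w j = 0.
  by move=> jN; apply: lau_eq => m;
     rewrite iterLE YN // (linear_zero (YWl w m)) lam0.
have vacE i m j : lam (YW (Y (Y u v j) vac i) w m) = flow P (iterL u v w j) i m.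
  rewrite -(iterLE (Y u v j) vac) iterL_vac; congr (flow P _ i m).
  by apply: lau_eq => l; rewrite iterLE (lserE lamF) //; apply: YWb.
pose h (a : V) := lam (YW a w n).
have hD a b : h (a + b) = h a + h b by rewrite /h (linear_add (YWl w n)) lamD.
have hZ c a : h (c *: a) = c * h a by rewrite /h (linear_scale (YWl w n)) lamZ.
have m1k : (-1) ^ k * (-1) ^ k = 1 :> K by rewrite -expfzMl mulrNN mulr1 exp1rz.
pose M := absz (k - N + 1).
have big_i i : (M <= i)%N -> k - i%:Z < N by rewrite /M; lia.
have [YL1 YL2 _] := va_field va.
rewrite -/(h (Y v u k)).
have -> : h (Y v u k) = \sum_(i < M) (-1) ^ k * ((-1) ^+ i
    * flow P (iterL u v w (k - i%:Z)) i n).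
  have yE : Y v u k = (-1) ^ k *: ((-1) ^ k *: Y v u k).
    by rewrite scalerA m1k scale1r.
  rewrite yE skew_symmetry hZ.
  rewrite (@fsumE _ _ (iota 0 M)) ?iota_uniq //; last first.
    move=> i; rewrite mem_iota add0n => iM; rewrite YN; last by apply: big_i; lia.
    by rewrite (linear_zero (YL1 vac i)) scaler0.
  rewrite (big_morph h hD (additive0 hD)) [LHS]mulr_sumr.
  transitivity (\sum_(0 <= i < M) (-1) ^ k * ((-1) ^+ i
    * flow P (iterL u v w (k - i%:Z)) i n)); last by rewrite big_mkord.
  by rewrite /index_iota subn0; apply: eq_bigr => i _; rewrite hZ /h vacE.
rewrite (fsum_rev k) (@fsum_nat _ M).
- rewrite lauc_sum; apply: eq_bigr => i _; rewrite subKr zsignD !zsignE.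
  rewrite -!lcst_signz -lcstM laucCM mulrA; congr (_ * _ * _).
  by rewrite -exprz_inv invrN1.
- by move=> i i0; rewrite flow_neg ?mulr0 // subKr.
- by move=> i iM; rewrite X0 ?flow_at0 ?mulr0 //; move: iM; rewrite /M; lia.
Qed.

End QuasiModules.

Section PolynomialQuotient.
Variable K : numFieldType.

Lemma polydiv_mul_widen (q : {poly K}) (A : int -> int -> K) N m n :
    (size q <= N)%N ->
  polydiv_mul (W := K^o) q A m n = \sum_(i < N) q`_i * A (m - i%:Z) (n + i%:Z).
Proof.
move=> qN; rewrite -[LHS]/(\sum_(i < size q) q`_i * A (m - i%:Z) (n + i%:Z)).
rewrite (big_ord_widen N (fun i => q`_i * A (m - i%:Z) (n + i%:Z)) qN).
rewrite big_mkcond; apply: eq_bigr => i _; case: ltnP => // qi.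
by rewrite nth_default ?mul0r.
Qed.

Lemma polydiv_mul_prod (rs : seq K) (A : int -> int -> K) :
  polydiv_mul (W := K^o) (\prod_(a <- rs) ('X - a%:P)) A = opl 1 1 rs A.
Proof.
elim: rs => [|a rs IH].
  apply: ext2 => m n; rewrite big_nil (@polydiv_mul_widen _ _ 1) ?size_poly1 //.
  by rewrite big_ord1 coefC mul1r subr0 addr0.
rewrite big_cons /= -IH; set q := \prod_(_ <- _) _; apply: ext2 => m n.
rewrite (@polydiv_mul_widen _ _ (size q).+1); last first.
  by rewrite size_XsubC_mul_leq || apply: leq_trans (size_polyMleq _ _) _;
     rewrite size_XsubC.
rewrite /rop mul1r (@polydiv_mul_widen q _ (size q)) //.
rewrite (@polydiv_mul_widen q _ (size q).+1) // mulr_sumr.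
transitivity (\sum_(i < (size q).+1) (('X * q)`_i * A (m - i%:Z) (n + i%:Z))
  - \sum_(i < (size q).+1) a * (q`_i * A (m - i%:Z) (n + i%:Z))).
  rewrite -sumrB; apply: eq_bigr => i _.
  by rewrite mulrBl coefB coefCM mulrBl mulrA.
congr (_ - _); rewrite big_ord_recl coefXM mul0r add0r; apply: eq_bigr => i _.
rewrite coefXM /= /bump leq0n add1n /=.
by congr (_ * A _ _); lia.
Qed.

End PolynomialQuotient.

Section Commutator.
Variable K : numClosedFieldType.
Notation L1 := (lau K).
Notation L2 := (lau L1).
Variables (p : int -> K) (p_laurent : laurent (p : int -> K^o)).
Hypothesis p_neq0 : exists n : int, p n <> 0.
Variables (G : groupType) (chi chi_phi : G -> K).
Hypothesis chi_phi_char : linear_character chi_phi.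
Hypothesis chi_compat : forall (g : G) (k n : int),
  chi g ^ k * phi p k n = chi_phi g * ((chi_phi g)^-1 ^ n * phi p k n).
Variables (V W : lmodType K) (Y : V -> V -> int -> V) (vac : V) (R : G -> V -> V).
Hypothesis V_va : vertex_algebra Y vac.
Variable YW : V -> W -> int -> W.
Hypothesis W_mod : equivariant_phi_quasi_module p chi_phi Y vac R YW.
Variables u v : V.

Let P : L1 := Lau p_laurent.
Let pP n : P n = p n. Proof. by []. Qed.
Let wm := epqm_module W_mod.

Lemma P_neq0 : P != 0.
Proof.
by have [n pn] := p_neq0; apply/eqP => P0; apply: pn; rewrite -pP P0.
Qed.

Lemma chi_mulV g : chi_phi g * chi_phi g^-1%g = 1.
Proof.
by rewrite -(linear_characterM chi_phi_char) mulgV linear_character1.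
Qed.

Lemma chi_neq0 g : chi_phi g != 0.
Proof.
apply: contra_eq_neq (chi_mulV g) => ->.
by rewrite mul0r eq_sym oner_neq0.
Qed.

Lemma chiV g : chi_phi g^-1%g = (chi_phi g)^-1.
Proof. by apply: (mulfI (chi_neq0 g)); rewrite chi_mulV divff ?chi_neq0. Qed.

(** K is algebraically closed, so q is given by its roots. *)
Lemma local_roots a b : exists rs : seq K,
  (forall c, c \in rs -> range chi_phi c) /\
  forall w lam, functional lam -> dlaurent (opl 1 1 rs (prodL YW lam a b w)).
Proof.
have [q [qm qr] ql] := epqm_local W_mod a b.
have [rs qE] := closed_field_poly_normal q.
have {}qE : q = \prod_(c <- rs) ('X - c%:P) by rewrite {1}qE (monicP qm) scale1r.
exists rs; split=> [c cs|w lam lamF].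
  by apply: qr; rewrite qE root_prod_XsubC.
have [N qN] := ql w; exists N.
rewrite -polydiv_mul_prod -qE => m n mn.
rewrite -[LHS]/(\sum_(i < size q) q`_i * lam (prodY YW a b w (m - i%:Z) (n + i%:Z))).
have [lD lZ] := lamF.
transitivity (lam (polydiv_mul q (prodY YW a b w) m n)).
  rewrite /polydiv_mul (big_morph lam lD (additive0 lD)).
  by apply: eq_bigr => i _; rewrite lZ.
by rewrite qN // (additive0 lD).
Qed.

(** Equivariance moves R_g^-1 into the variable: z1 becomes chi_phi(g) z1. *)
Lemma prodL_equivariant g w lam : functional lam ->
  prodL YW lam (R g^-1%g u) v w = scale1 (chi_phi g) (prodL YW lam u v w).
Proof.
move=> [_ lZ]; apply: ext2 => m n.
by rewrite /prodL /prodY (epqm_equiv W_mod) lZ chiV invrK.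
Qed.

(** Q collects the roots for (u, v) and the inverses of the roots for (v, u),
    since exchanging z1 and z2 inverts z1/z2; the image of chi_phi is closed
    under inverses. *)
Lemma common_numerator : exists rs : seq K,
  (forall c, c \in rs -> range chi_phi c) /\
  forall w lam, functional lam -> exists F : int -> int -> K,
  [/\ dlaurent F, opl 1 1 rs (prodL YW lam u v w) = F,
      opl 1 1 rs (tr (prodL YW lam v u w)) = F &
      forall g, phisub P (scale1 (chi_phi g) F)
        = qval (xi_at P (chi_phi g)) rs * iterL Y YW lam (R g^-1%g u) v w].
Proof.
have [as_ [asR asL]] := local_roots u v; have [bs [bsR bsL]] := local_roots v u.
have [ord [Pv0 Pv]] := lau_valP P_neq0.
exists (as_ ++ [seq b^-1 | b <- bs]); set rs := _ ++ _.
split=> [c|w lam lamF].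
  rewrite mem_cat => /orP[/asR//|/mapP[b /bsR[g _ <-] ->]].
  by exists g^-1%g => //; rewrite chiV.
set A := prodL YW lam u v w; set B := tr (prodL YW lam v u w).
have bs0 b : b \in bs -> b != 0 by move=> /bsR[g _ <-]; apply: chi_neq0.
have dB : dlaurent (opl 1 1 [seq b^-1 | b <- bs] B).
  apply: dlaurent_opl_inv => //; rewrite -tr_opl.
  by apply: dlaurent_tr; apply: bsL.
have dFA : dlaurent (opl 1 1 rs A).
  rewrite opl_cat opl_comm.
  by have [] := phisub_opl P 1 1 [seq b^-1 | b <- bs] (asL w lam lamF).
have dFB : dlaurent (opl 1 1 rs B).
  by rewrite opl_cat; have [] := phisub_opl P 1 1 as_ dB.
have tA : phisub P (opl 1 1 rs A)
    = (\prod_(s <- rs) ropval P 1 1 s) * iterL Y YW lam u v w.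
  have [f f0 /(_ w)[df fx]] := assocL pP V_va wm lamF u v.
  exact: (phisub_opl_assoc Pv Pv0 f0 df fx).
have tB : phisub P (opl 1 1 rs B)
    = (\prod_(s <- rs) ropval P 1 1 s) * iterL Y YW lam u v w.
  have [f f0 /(_ w)[df fx]] := assocL pP V_va wm lamF v u.
  have dC : dlaurent (opl (-1) 1 rs (prodL YW lam v u w)).
    by rewrite -[prodL _ _ _ _ _]/(tr B) -tr_opl; apply: dlaurent_tr.
  have -> : opl 1 1 rs B = tr (opl (-1) 1 rs (prodL YW lam v u w)).
    by rewrite tr_opl opprK.
  rewrite -flip_phisub // (phisub_opl_assoc Pv Pv0 f0 df fx) // flip_opl.
  by rewrite (flip_iterL pP P_neq0 V_va wm lamF) flipK.
have FAB : opl 1 1 rs A = opl 1 1 rs B.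
  by apply: (phisub_inj Pv Pv0) => //; rewrite tA tB.
exists (opl 1 1 rs A); split=> // g.
have [f f0 /(_ w)[df fx]] := assocL pP V_va wm lamF (R g^-1%g u) v.
have dS := dlaurent_scale1 (chi_phi g) dFA.
rewrite scale1_opl ?chi_neq0 // -prodL_equivariant // in dS *.
by rewrite (phisub_opl_assoc Pv Pv0 f0 df fx dS) opl1_xi.
Qed.

(** The coefficient of z in the compatibility condition, phi being
    x + z p(x) + ... *)
Lemma chi_p g n : chi g * p n = chi_phi g * ((chi_phi g)^-1 ^ n * p n).
Proof.
have := chi_compat g 1 n; rewrite expr1z (phiE pP).
suff -> : phi0 P 1 n = p n by [].
rewrite /phi0 (flow_pos _ _ 1) invr1 mul1r [iter _ _ _]/(vder P (zvar K)).
by rewrite /vder ldiff_zvar mulr1.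
Qed.

(** With e = chi_phi(g), the delta function evaluates pbar at e z2 and has the
    coefficient (e z2)^(-m) in degree m of z1; by [chi_p], chi(g) p(e z2) is
    e p(z2). *)
Lemma pbar_deltaE g m n : pbar_delta p (chi g) (chi_phi g) m n
  = (lcst (chi_phi g ^ (- m)) * (lmono 1 (- m - 1) * P)) n.
Proof.
rewrite laucCM lauc_mono mul1r /pbar_delta /lmul (@zsum1 _ (m + n)); last first.
  move=> i imn; rewrite /delta_ratio ifF; first exact: mulr0.
  by apply: contraNF imn => /eqP mi; apply/eqP; lia.
rewrite /delta_ratio (_ : m - (m + n) = - n) ?eqxx; last by lia.
rewrite -[_ *: _]/(p (m + n + 1) * chi_phi g ^ n) mulrA chi_p.
have g0 := chi_neq0 g; rewrite (_ : n - (- m - 1) = m + n + 1); last by lia.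
rewrite pP exprz_inv mulrA mulrAC; congr (_ * _).
rewrite -[X in X * _ * _]expr1z -!expfzDr //; congr (_ ^ _); lia.
Qed.

Lemma res_termE g w lam m n : functional lam ->
  lam (res_term p chi chi_phi Y R YW u v g w m n)
  = (flow P (lcst (chi_phi g ^ (- m)) * (lmono 1 (- m - 1) * P))
      * iterL Y YW lam (R g^-1%g u) v w) (-1) n.
Proof.
move=> lamF; rewrite /res_term; set b := _ * (_ * P).
have idF : functional (fun x : K^o => x) by split.
have bE : (pbar_delta p (chi g) (chi_phi g) m : int -> K^o) = b.
  by apply: funext => i; rewrite pbar_deltaE.
apply: (lser2_lmul2 lamF).
- move=> i j; rewrite bE (lser_exp pP idF); last exact: lauP.
  congr (flow P _ i j); apply: lau_eq => l; rewrite (lserE idF) //.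
  exact: lauP.
- exact: (iterY_below V_va wm).
- by move=> k; have [_ _ YWb] := pqm_field wm; apply: YWb.
Qed.

Variable psi : K -> G.
Hypothesis psi_section : forall g : G, chi_phi (psi (chi_phi g)) = chi_phi g.

Theorem commutator_formula :
  finite_set [set g | (psi @` range chi_phi) g /\
                      res_term p chi chi_phi Y R YW u v g <> (fun _ _ _ => 0)] /\
  forall (w : W) (m n : int),
    commY YW u v w m n
    = \sum_(g \in psi @` range chi_phi)
        res_term p chi chi_phi Y R YW u v g w m n.
Proof.
have [rs [rsR rsF]] := common_numerator.
have psiK e : range chi_phi e -> chi_phi (psi e) = e.
  by move=> [g _ <-]; apply: psi_section.
have termE w lam (lamF : functional lam) F :
    (forall g, phisub P (scale1 (chi_phi g) F)
        = qval (xi_at P (chi_phi g)) rs * iterL Y YW lam (R g^-1%g u) v w) ->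
    dlaurent F -> forall g m n, lam (res_term p chi chi_phi Y R YW u v g w m n)
      = res_at P (chi_phi g) (zshift (- m - 1) 0 F) rs n.
  move=> FX dF g m n.
  by rewrite res_termE // (res_at_term m P_neq0 (chi_neq0 g) dF (FX g)).
have term0 g : chi_phi g \notin rs ->
    res_term p chi chi_phi Y R YW u v g = fun _ _ _ => 0.
  move=> grs; apply: funext => w; do 2![apply: funext => ?].
  apply: functional_ext => lam lamF; have [F [dF _ _ FX]] := rsF w lam lamF.
  by rewrite (termE w lam lamF F) // res_at_regular // (additive0 (proj1 lamF)).
split.
  apply: (@sub_finite_set _ _ (psi @` [set` rs])); last first.
    by apply: finite_image; apply: finite_seq.
  move=> _ [[e er <-] nz]; exists e => //; apply: contrapT => /negP ers.
  by apply: nz; apply: term0; rewrite psiK.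
move=> w m n; pose D := undup rs.
have DR e : e \in D -> range chi_phi e by rewrite mem_undup => /rsR.
have D0 : 0 \notin D.
  by apply/negP => /DR[g _ g0]; have := chi_neq0 g; rewrite g0 eqxx.
rewrite (fsbigE (map psi D)); first last.
- move=> _ [e er <-] eD; rewrite term0 // psiK //; apply: contra eD => ers.
  by apply: map_f; rewrite mem_undup.
- by move=> g /mapP[e eD ->]; exists e => //; apply: DR.
- rewrite map_inj_in_uniq ?undup_uniq // => e1 e2 /DR e1R /DR e2R.
  by move=> /(congr1 chi_phi); rewrite !psiK.
rewrite big_map big_mkcond /=.
have -> : \sum_(e <- D) (if psi e \in psi @` range chi_phi
      then res_term p chi chi_phi Y R YW u v (psi e) w m n else 0)
    = \sum_(e <- D) res_term p chi chi_phi Y R YW u v (psi e) w m n.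
  apply: eq_big_seq => e eD; rewrite ifT // inE; exists e => //; exact: DR.
apply: functional_ext => lam lamF; have [F [dF FA FB FX]] := rsF w lam lamF.
have [lD lZ] := lamF; have [YWl YWr YWb] := pqm_field wm.
rewrite (big_morph lam lD (additive0 lD)).
have iter12P a b : iter12 (prodL YW lam a b w).
  split.
    have [N bN] := YWb b w; exists N => i j jN.
    by rewrite /prodL /prodY bN // (linear_zero (YWr a i)) (additive0 lD).
  move=> j; have [N aN] := YWb a (YW b w j); exists N => i iN.
  by rewrite /prodL /prodY aN // (additive0 lD).
have subD : {subset rs <= D} by move=> e; rewrite mem_undup.
rewrite /commY (additiveB lD) -[lam (prodY _ u v w m n)]/(prodL YW lam u v w m n).
rewrite -[lam (prodY _ v u w n m)]/(tr (prodL YW lam v u w) m n).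
rewrite (commutator_residues P_neq0 dF (iter12P u v) (iter12P v u) FA FB
  (undup_uniq rs) D0 subD).
rewrite lauc_sum; apply: eq_big_seq => e eD.
by rewrite (termE w lam lamF F) // psiK //; apply: DR.
Qed.

End Commutator.

Unset Implicit Arguments.

Theorem proposition5p3 (F : realType) (p : int -> F[i])
    (p_laurent : laurent (p : int -> F[i]^o))
    (p_neq0 : exists n : int, p n <> 0)
    (G : groupType) (chi chi_phi : G -> F[i])
    (chi_char : linear_character chi) (chi_phi_char : linear_character chi_phi)
    (chi_compat : forall (g : G) (k n : int),
       chi g ^ k * phi p k n = chi_phi g * ((chi_phi g)^-1 ^ n * phi p k n))
    (V : lmodType F[i]) (Y : V -> V -> int -> V) (vac : V) (R : G -> V -> V)
    (V_va : G_vertex_algebra chi Y vac R)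
    (W : lmodType F[i]) (YW : V -> W -> int -> W)
    (W_mod : equivariant_phi_quasi_module p chi_phi Y vac R YW)
    (psi : F[i] -> G)
    (psi_section : forall g : G, chi_phi (psi (chi_phi g)) = chi_phi g)
    (u v : V) :
  finite_set [set g | (psi @` range chi_phi) g /\
                      res_term p chi chi_phi Y R YW u v g <> (fun _ _ _ => 0)] /\
  forall (w : W) (m n : int),
    commY YW u v w m n
    = \sum_(g \in psi @` range chi_phi)
        res_term p chi chi_phi Y R YW u v g w m n.
Proof.
exact: (commutator_formula p_laurent p_neq0 chi_phi_char chi_compat
  (Gva_va V_va) W_mod u v psi_section).
Qed.
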